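(* Let $K_1$ and $K_2$ be oriented Legendrian knots of the same topological knot type with $tb(K_1)=tb(K_2)$ and $rot(K_1)=rot(K_2)$. Then for every finite block GL-rack $(X,\ast,u,d)$, $\operatorname{Col}_X(K_1)=\operatorname{Col}_X(K_2)$.
   Context: A rack is a set $X$ with a binary operation $\ast$ such that for every $y\in X$ the map $x\mapsto x\ast y$ is a bijection of $X$ and $(x\ast y)\ast z=(x\ast z)\ast(y\ast z)$ for all $x,y,z$. A GL-rack is a quadruple $(X,\ast,u,d)$ where $(X,\ast)$ is a rack and $u,d\colon X\to X$ are maps such that for all $x,y\in X$: $u(d(x\ast x))=d(u(x\ast x))=x$; $u(x\ast y)=u(x)\ast y$ and $d(x\ast y)=d(x)\ast y$; $x\ast u(y)=x\ast d(y)=x\ast y$. The diagonal map is $\Delta(x)=x\ast x$; for finite $X$ it is a bijection with $\Delta=(u\circ d)^{-1}$. A finite GL-rack is a block GL-rack if all cycles in the disjoint cycle decomposition of $\Delta$ (fixed points counted as $1$-cycles) have the same length. Legendrian knots lie in $(\mathbb{R}^3,\xi_{\mathrm{std}})$, $\xi_{\mathrm{std}}=\mathrm{span}\{\partial_y,\partial_x+y\partial_z\}$, and are represented by oriented front diagrams. For a front diagram $D$ of $K$ with writhe $w(D)$, $u(D)$ cusps traversed upward and $d(D)$ cusps traversed downward, $tb(K)=w(D)-\frac12(u(D)+d(D))$ and $rot(K)=\frac12(d(D)-u(D))$. Given a finite GL-rack $X$, a coloring of $D$ is an assignment of elements of $X$ to the semi-arcs of $D$ (segments bounded by undercrossings or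 cusps) such that, following the orientation through a cusp, the color changes from $x$ to $u(x)$ if the cusp is traversed upward and to $d(x)$ if traversed downward; and at each crossing whose over-strand is colored $y$, if the under semi-arc on the right of the oriented over-strand is colored $x$, the one on its left is colored $x\ast y$. $\operatorname{Col}_X(K)$ is the number of colorings; it is a Legendrian isotopy invariant, equal to $|\operatorname{Hom}(\operatorname{GLR}(K),X)|$ for the fundamental GL-rack $\operatorname{GLR}(K)$. *)

(* Defs.v *)
From Stdlib Require Import Relations.
From HB Require Import structures.
From mathcomp Require Import all_boot all_order all_algebra.
Set Implicit Arguments. Unset Strict Implicit. Unset Printing Implicit Defensive.
Import GRing.Theory Num.Theory.

(* Diagrams in Morse position, read from left (x small) to right.       *)
(* At each vertical slice the diagram meets finitely many strands,      *)
(* numbered 0,1,2,... from bottom (z small) to top.                     *)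
(*   Cup i   : a left cusp / local minimum in x: two new strands appear  *)
(*             at positions i, i+1 (strands >= i are shifted up by 2).   *)
(*   Cap i   : a right cusp / local maximum in x: strands i, i+1 join.   *)
(*   Cr i b  : strands i and i+1 cross.  The strand going from i+1 to i  *)
(*             ("descending", smaller slope) is the over-strand iff b.   *)
(* A Legendrian front is such a word in which every crossing has b=true *)
(* (in a front the strand of smaller slope is always in front); its     *)
(* Cups/Caps are its left/right cusps.                                   *)
Inductive piece := Cup of nat | Cap of nat | Cr of nat & bool.

Definition pdefault := Cr 0 true.

Definition wd (q : piece) (n : nat) : nat :=
  match q with Cup _ => n.+2 | Cap _ => n.-2 | Cr _ _ => n end.

Definition width_at (w : seq piece) (k : nat) : nat :=
  foldl (fun n q => wd q n) 0 (take k w).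

Definition piece_ok (q : piece) (n : nat) : bool :=
  match q with Cup i => i <= n | Cap i => i.+2 <= n | Cr i _ => i.+2 <= n end.

Definition valid (w : seq piece) : bool :=
  all (fun k => piece_ok (nth pdefault w k) (width_at w k)) (iota 0 (size w))
  && (width_at w (size w) == 0).

(* where strand p of the slice to the left of q goes in the slice to its right *)
Definition next (q : piece) (p : nat) : option nat :=
  match q with
  | Cup i => Some (if p < i then p else p.+2)
  | Cap i => if p < i then Some p else if p < i.+2 then None else Some (p - 2)
  | Cr i _ => Some (if p == i then i.+1 else if p == i.+1 then i else p)
  end.

Definition is_front (w : seq piece) : bool :=
  all (fun q => if q is Cr _ b then b else true) w.

(* Orientation: o k p = true iff strand p of slice k is oriented to the right *)
Definition oriented (w : seq piece) (o : nat -> nat -> bool) : Prop :=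
  forall k, k < size w ->
    (forall p p', p < width_at w k -> next (nth pdefault w k) p = Some p' ->
                  o k.+1 p' = o k p) /\
    match nth pdefault w k with
    | Cup i => o k.+1 i != o k.+1 i.+1
    | Cap i => o k i != o k i.+1
    | Cr _ _ => True
    end.

(* semi-segments: strand p of slice k *)
Definition seg (w : seq piece) :=
  {x : 'I_(size w).+1 * 'I_(2 * size w).+1 | x.2 < width_at w x.1}.
Definition sk (w : seq piece) (s : seg w) : nat := (sval s).1.
Definition sp (w : seq piece) (s : seg w) : nat := (sval s).2.

Definition link (w : seq piece) (k : 'I_(size w)) (s t : seg w) : bool :=
  let q := nth pdefault w k in
  [|| [&& sk s == k, sk t == k.+1 & next q (sp s) == Some (sp t)],
      (if q is Cup i then [&& sk s == k.+1, sk t == k.+1, sp s == i & sp t == i.+1]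
       else false)
    | (if q is Cap i then [&& sk s == k, sk t == k, sp s == i & sp t == i.+1]
       else false)].

Definition adj (w : seq piece) : rel (seg w) :=
  fun s t => [exists k, link k s t || link k t s].

Definition is_knot (w : seq piece) : bool :=
  [&& valid w, 0 < size w & [forall s : seg w, forall t : seg w, connect (@adj w) s t]].

Local Open Scope ring_scope.

Definition csign (w : seq piece) (o : nat -> nat -> bool) (k : nat) : int :=
  if nth pdefault w k is Cr i _ then (if o k i == o k i.+1 then 1 else -1) else 0.

Definition writhe (w : seq piece) (o : nat -> nat -> bool) : int :=
  \sum_(k < size w) csign w o k.

Definition up_cusp (w : seq piece) (o : nat -> nat -> bool) (k : nat) : bool :=
  match nth pdefault w k with
  | Cup i => ~~ o k.+1 i
  | Cap i => o k i
  | Cr _ _ => false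
  end.
Definition down_cusp (w : seq piece) (o : nat -> nat -> bool) (k : nat) : bool :=
  match nth pdefault w k with
  | Cup i => o k.+1 i
  | Cap i => ~~ o k i
  | Cr _ _ => false
  end.

Definition n_up w o : nat := count (up_cusp w o) (iota 0 (size w)).
Definition n_down w o : nat := count (down_cusp w o) (iota 0 (size w)).

Definition legtb (w : seq piece) (o : nat -> nat -> bool) : rat :=
  (writhe w o)%:~R - ((n_up w o + n_down w o)%:R / 2).
Definition legrot (w : seq piece) (o : nat -> nat -> bool) : rat :=
  ((n_down w o)%:R - (n_up w o)%:R) / 2.

Local Close Scope ring_scope.

Definition is_rack (X : Type) (op : X -> X -> X) : Prop :=
  (forall y, bijective (fun x => op x y)) /\
  (forall x y z, op (op x y) z = op (op x z) (op y z)).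

Definition GLrack (X : Type) (op : X -> X -> X) (u d : X -> X) : Prop :=
  [/\ is_rack op,
      (forall x, u (d (op x x)) = x) /\ (forall x, d (u (op x x)) = x),
      (forall x y, u (op x y) = op (u x) y) /\ (forall x y, d (op x y) = op (d x) y)
    & (forall x y, op x (u y) = op x y) /\ (forall x y, op x (d y) = op x y)].

Definition diag (X : Type) (op : X -> X -> X) : X -> X := fun x => op x x.

Definition block_rack (X : finType) (op : X -> X -> X) : Prop :=
  forall x y : X, fingraph.order (diag op) x = fingraph.order (diag op) y.

Definition col_ok (X : finType) (op : X -> X -> X) (u d : X -> X)
    (w : seq piece) (o : nat -> nat -> bool) (f : {ffun seg w -> X})
    (k : 'I_(size w)) (s1 s2 t : seg w) : bool :=
  let q := nth pdefault w k in
  [&& (* color is kept along a strand, except along the under-strand of a crossing *)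
      ([&& sk s1 == k, sk t == k.+1, next q (sp s1) == Some (sp t)
         & ~~ (if q is Cr i _ then sp s1 == i else false)] ==> (f t == f s1)),
      (* crossing: over-strand s2 (colour y), under semi-arcs s1 (left) and t (right) *)
      (if q is Cr i _ then
         [&& sk s1 == k, sk s2 == k, sk t == k.+1, sp s1 == i, sp s2 == i.+1
           & sp t == i.+1] ==>
         (if o k i.+1 then f t == op (f s1) (f s2) else f s1 == op (f t) (f s2))
       else true),
      (* left cusp: s1 lower branch, s2 upper branch *)
      (if q is Cup i then
         [&& sk s1 == k.+1, sk s2 == k.+1, sp s1 == i & sp s2 == i.+1] ==>
         (if o k.+1 i then f s1 == d (f s2) else f s2 == u (f s1))
       else true)
    & (* right cusp: s1 lower branch, s2 upper branch *)
      (if q is Cap i then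
         [&& sk s1 == k, sk s2 == k, sp s1 == i & sp s2 == i.+1] ==>
         (if o k i then f s2 == u (f s1) else f s1 == d (f s2))
       else true)].

Definition Col (X : finType) (op : X -> X -> X) (u d : X -> X)
    (w : seq piece) (o : nat -> nat -> bool) : nat :=
  #|[set f : {ffun seg w -> X} |
      [forall k, forall s1, forall s2, forall t, col_ok op u d o f k s1 s2 t]]|.

(* Topological equivalence of oriented knot diagrams: Reidemeister      *)
(* moves together with the planar-isotopy (Morse/Turaev) moves.         *)
Definition pidx (q : piece) : nat := match q with Cup i | Cap i | Cr i _ => i end.
Definition pin (q : piece) : nat := match q with Cup _ => 0 | _ => 2 end.
Definition pout (q : piece) : nat := match q with Cap _ => 0 | _ => 2 end.
Definition setidx (q : piece) (j : nat) : piece :=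
  match q with Cup _ => Cup j | Cap _ => Cap j | Cr _ b => Cr j b end.

Inductive move : seq piece -> seq piece -> Prop :=
  (* far commutativity: q acts on strands above everything p touches *)
  | mv_far p q : (pidx p + pout p <= pidx q)%N ->
      move [:: p; q] [:: setidx q (pidx q - pout p + pin p)%N; p]
  | mv_snake1 i : move [:: Cup i; Cap i.+1] [::]
  | mv_snake2 i : move [:: Cup i.+1; Cap i] [::]
  | mv_R1a i b : move [:: Cup i.+1; Cr i b; Cap i.+1] [::]
  | mv_R1b i b : move [:: Cup i; Cr i.+1 b; Cap i] [::]
  | mv_R2 i b : move [:: Cr i b; Cr i (~~ b)] [::]
  (* Reidemeister III (the three strands are stacked, no cyclic over-relation) *)
  | mv_R3 i b1 b2 b3 : ~~ ((b1 == b3) && (b2 != b1)) ->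
      move [:: Cr i b1; Cr i.+1 b2; Cr i b3] [:: Cr i.+1 b3; Cr i b2; Cr i.+1 b1]
  | mv_capslide i b : move [:: Cr i b; Cap i.+1] [:: Cr i.+1 (~~ b); Cap i]
  | mv_cupslide i b : move [:: Cup i.+1; Cr i b] [:: Cup i; Cr i.+1 (~~ b)].

Definition odiag := (seq piece * (nat -> nat -> bool))%type.

Definition oeq (w : seq piece) (o o' : nat -> nat -> bool) : Prop :=
  forall k p, (k <= size w)%N -> p < width_at w k -> o k p = o' k p.

Definition top_step (D D' : odiag) : Prop :=
  let w := D.1 in let o := D.2 in let w' := D'.1 in let o' := D'.2 in
  [/\ valid w, valid w', oriented w o, oriented w' o' &
   (w = w' /\ oeq w o o') \/
   exists a l r b, [/\ w = a ++ l ++ b, w' = a ++ r ++ b, move l r \/ move r l,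
     (forall k p, (k <= size a)%N -> p < width_at w k -> o' k p = o k p) &
     (forall j p, p < width_at w (size a + size l + j) ->
        o' (size a + size r + j)%N p = o (size a + size l + j)%N p)]].

Definition top_equiv : odiag -> odiag -> Prop := clos_refl_sym_trans odiag top_step.

(* Main.v *)
From Stdlib Require Import Relations.
From mathcomp Require Import all_boot all_order all_algebra all_fingroup zify lra.
From mathcomp Require Import boolp.
Require Import Defs.
Set Implicit Arguments. Unset Strict Implicit. Unset Printing Implicit Defensive.
Import GRing.Theory.

(* Since [u] and [d] commute with every right translation and do not affect the
   operators, replacing [x * y] by [x |> y := Delta^-1 (x * y)] turns the GL-rack
   into a quandle on which [u] and [d] generate an abelian group of twists; the
   cusps and the correction at each crossing become twists placed on the strands
   of an ordinary quandle coloring. A twist may slide along its strand without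
   changing the number of colorings, so for a knot only the total twist matters.
   Before each Reidemeister move the twists are slid out of the region being
   modified; the move then preserves the number of colorings and the total.
   For a front the total is u^(n_u - w) d^(n_d - w), which is determined by the
   Thurston-Bennequin and rotation numbers since Delta^-1 = ud. *)

(** Orientations, conserved flows of twists and colorings are all colorings of a word by a symmetric
    quandle: [bool_sq], [zmod_sq A] and [double_sq], where the orientation is the sign coordinate of
    the color. Each move is therefore checked once, for an arbitrary symmetric quandle and without
    orientations, and then used for colors and for orientations alike. Invariance of the count
    splits into existence ([transfers]) and uniqueness ([determined]) of the colors inside the
    region, given those at its two ends. Emptying the region of twists further requires that each of
    its slots be joined to an end within the region ([exiting]). A move may delete every slice
    between the two borders, which then become a single slice; so that twists from the two sides
    remain apart, a slot carries twists at both of its ends, [L] and [R]. Intermediate diagrams are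
    never shown to be knots: along an equivalence only some placement of twists is transported, with
    its count and its total, and connectedness enters at the last diagram alone. *)

Notation nxt := Defs.next.

(** * Words of pieces and their widths *)

Definition eqn C (n : nat) (x y : nat -> C) := forall p, p < n -> x p = y p.

Lemma eqn_sym C n (x y : nat -> C) : eqn n x y -> eqn n y x.
Proof. by move=> h p /h. Qed.

(** A subword in the middle of a diagram is entered by [n] strands, so widths are computed from an
    arbitrary start; for [n = 0] this is [width_at]. *)
Definition wfrom (n : nat) (w : seq piece) (k : nat) : nat :=
  foldl (fun n q => wd q n) n (take k w).

Definition okfrom (n : nat) (w : seq piece) :=
  forall k, k < size w -> piece_ok (nth pdefault w k) (wfrom n w k).

Lemma wfrom0 n w : wfrom n w 0 = n.
Proof. by rewrite /wfrom take0. Qed.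

Lemma wfromS n w k : k < size w ->
  wfrom n w k.+1 = wd (nth pdefault w k) (wfrom n w k).
Proof. by move=> hk; rewrite /wfrom (take_nth pdefault hk) foldl_rcons. Qed.

Lemma wfrom_catl n a b k : k <= size a -> wfrom n (a ++ b) k = wfrom n a k.
Proof.
move=> hk; rewrite /wfrom take_cat; case: ltnP => // h.
have -> : k = size a by lia.
by rewrite subnn take0 cats0 take_size.
Qed.

Lemma wfrom_catr n a b k :
  wfrom n (a ++ b) (size a + k) = wfrom (wfrom n a (size a)) b k.
Proof.
have e : (size a + k < size a) = false by lia.
by rewrite /wfrom take_cat e foldl_cat take_size addKn.
Qed.

Lemma okfrom_cat n a b : okfrom n (a ++ b) ->
  okfrom n a /\ okfrom (wfrom n a (size a)) b.
Proof.
move=> h; split=> k hk.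
- have := h k; rewrite size_cat nth_cat hk wfrom_catl ?(ltnW hk) //; apply; lia.
- have := h (size a + k); rewrite size_cat nth_cat wfrom_catr.
  have -> : (size a + k < size a) = false by lia.
  by rewrite addKn; apply; lia.
Qed.

(** * Symmetric quandles and colorings of tangle words *)

(* Kamada's good involution [tau]: it models reversal of the orientation, so
   that colorings by a symmetric quandle need no orientation of the diagram. *)
Record symquandle := SymQuandle {
  car :> Type;
  tau : car -> car;
  tri : car -> car -> car;
  tauK : forall x, tau (tau x) = x;
  triK : forall x y, tri (tri x y) (tau y) = x;
  tau_tri : forall x y, tau (tri x y) = tri (tau x) y;
  tri_id : forall x, tri x x = x;
  tri_dist : forall x y z, tri (tri x y) z = tri (tri x z) (tri y z) }.

Section Layers.
Variable C : symquandle.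
Implicit Types (x y z : nat -> C) (q : piece) (F G : nat -> nat -> C).

Lemma triKV (a b : C) : tri (tri a (tau b)) b = a.
Proof. by rewrite -{2}(tauK b) triK. Qed.

Lemma tri_tau_id (a : C) : tri a (tau a) = a.
Proof. by rewrite -{1}(tri_id a) triK. Qed.

Lemma tau_inj (a b : C) : tau a = tau b -> a = b.
Proof. by move=> e; rewrite -(tauK a) e tauK. Qed.

(** All strands are read from left to right, so the two legs of a cusp differ by [tau]. If [b] is
    false the over-strand ascends and the under-strand meets it from the other side; this is why the
    inverse operator, that of [tau x0], appears. *)
Definition core q (x0 x1 y0 y1 : C) : Prop :=
  match q with
  | Cup _ => y1 = tau y0
  | Cap _ => x1 = tau x0
  | Cr _ b => if b then y0 = x1 /\ y1 = tri x0 x1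
              else y1 = x0 /\ y0 = tri x1 (tau x0)
  end.

(** The shift above the piece is written as an equation between sums because [pout q - pin q] is
    negative for a cap. *)
Definition layer q n x y : Prop :=
  let i := pidx q in
  [/\ forall p, p < i -> y p = x p,
      forall p p', i + pin q <= p -> p < n -> p' + pin q = p + pout q ->
        y p' = x p
    & core q (x i) (x i.+1) (y i) (y i.+1)].

Definition chain (l : seq piece) n F : Prop :=
  forall k, k < size l ->
    layer (nth pdefault l k) (wfrom n l k) (F k) (F k.+1).

Lemma chain2 p q n F : chain [:: p; q] n F <->
  layer p n (F 0) (F 1) /\ layer q (wd p n) (F 1) (F 2).
Proof.
split=> [h|[h0 h1] [|[|k]] //].
by split; [exact: (h 0 isT)|exact: (h 1 isT)].
Qed.

Lemma chain3 p q r n F : chain [:: p; q; r] n F <->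
  [/\ layer p n (F 0) (F 1), layer q (wd p n) (F 1) (F 2)
    & layer r (wd q (wd p n)) (F 2) (F 3)].
Proof.
split=> [h|[h0 h1 h2] [|[|[|k]]] //].
by split; [exact: (h 0 isT)|exact: (h 1 isT)|exact: (h 2 isT)].
Qed.

(** Slices are total functions on [nat]; this lemma makes their values beyond the width
    irrelevant. *)
Lemma layer_congr q n x x' y y' : piece_ok q n -> eqn n x x' ->
  eqn (wd q n) y y' -> layer q n x y -> layer q n x' y'.
Proof.
move=> okq ex ey [lo hi co]; split.
- move=> p hp; rewrite -ex -?ey ?lo //; move: okq hp; case: q {ey lo hi co} => *; simpl in *; lia.
- move=> p p' h1 h2 h3; rewrite -ex -?ey //; first exact: hi h3.
  by move: okq h1 h2 h3; case: q {ey lo hi co} => *; simpl in *; lia.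
- move: okq ey co; case: q {lo hi} => [i|i|i []] /= okq ey co; rewrite -?ex -?ey //; lia.
Qed.

Definition set2 (i : nat) (a b : C) x : nat -> C :=
  fun p => if p == i then a else if p == i.+1 then b else x p.

Definition crs i (b : bool) x : nat -> C :=
  if b then set2 i (x i.+1) (tri (x i) (x i.+1)) x
  else set2 i (tri (x i.+1) (tau (x i))) (x i) x.

Lemma layer_crs i b n x : layer (Cr i b) n x (crs i b x).
Proof.
rewrite /crs /set2; split=> /=.
- by move=> p hp; case: b => /=; rewrite !ifF //; lia.
- move=> p p' h1 h2 h3; have -> : p' = p by lia.
  by case: b => /=; rewrite !ifF //; lia.
- by case: b => /=; rewrite !eqxx (_ : (i.+1 == i) = false) ?eqxx //; lia.
Qed.

Lemma layer_crsE i b n x y : i.+2 <= n ->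
  layer (Cr i b) n x y -> eqn n y (crs i b x).
Proof.
move=> hi [lo hh co] p hp.
have [h|h] := ltnP p i; first by rewrite lo // /crs /set2; case: (b); rewrite !ifF //; lia.
have [h'|h'] := leqP (i + 2) p.
  by rewrite (hh p p) //= /crs /set2; case: (b); rewrite !ifF //; lia.
have [->|->] : p = i \/ p = i.+1 by lia.
- by rewrite /crs /set2; move: co => /=; case: (b) => [] []; rewrite !eqxx.
- by rewrite /crs /set2; move: co => /=; case: (b) => [] [];
     rewrite !eqxx (_ : (i.+1 == i) = false) //; lia.
Qed.

Lemma crsE_layer i b n x y : i.+2 <= n ->
  eqn n y (crs i b x) -> layer (Cr i b) n x y.
Proof. by move=> hi e; apply: layer_congr (layer_crs i b n x) => //; exact: eqn_sym. Qed.

Lemma crs_invl i b x p : crs i (~~ b) (crs i b x) p = x p.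
Proof.
rewrite /crs /set2; case: b => /=; rewrite !eqxx (_ : (i.+1 == i) = false); try lia;
  case: (eqVneq p i) => [->|_]; rewrite ?triK ?triKV //;
  by case: (eqVneq p i.+1) => [->|_]; rewrite ?triK ?triKV.
Qed.

Lemma crs_congr i b n x x' : i.+2 <= n -> eqn n x x' ->
  eqn n (crs i b x) (crs i b x').
Proof.
by move=> hi e p hp; rewrite /crs /set2; case: (b); rewrite !e //; lia.
Qed.

Lemma layer_fwd q n x1 x2 y1 y2 : piece_ok q n -> pout q = 0 \/ pin q = 2 ->
  layer q n x1 y1 -> layer q n x2 y2 -> eqn n x1 x2 -> eqn (wd q n) y1 y2.
Proof.
case: q => [i|i|i b] /= okq nc; first by case: nc.
- move=> [lo hi _] [lo' hi' _] e p hp; have [h|h] := ltnP p i.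
    by rewrite lo // lo' // e //; lia.
  by rewrite (hi (p + 2)) ?(hi' (p + 2)) ?e //=; lia.
- move=> l1 l2 e p hp; have h1 := layer_crsE okq l1; have h2 := layer_crsE okq l2.
  by rewrite (h1 p hp) (h2 p hp) (crs_congr b okq e).
Qed.

Lemma layer_bwd q n x1 x2 y1 y2 : piece_ok q n -> pout q = 2 ->
  layer q n x1 y1 -> layer q n x2 y2 -> eqn (wd q n) y1 y2 -> eqn n x1 x2.
Proof.
case: q => [i|i|i b] //= okq _.
- move=> [lo hi _] [lo' hi' _] e p hp; have [h|h] := ltnP p i.
    by rewrite -lo // -lo' // e //; lia.
  by rewrite -(hi p (p + 2)) -?(hi' p (p + 2)) ?e //=; lia.
- move=> l1 l2 e p hp; have h1 := layer_crsE okq l1; have h2 := layer_crsE okq l2.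
  rewrite -(crs_invl i b x1) -(crs_invl i b x2).
  by apply: (@crs_congr i _ n) => // r hr; rewrite -(h1 r hr) -(h2 r hr) e.
Qed.

(** One end alone may not suffice: when a cup is followed by a distant cap above it, the middle
    slice takes the colors of the new arc from the right and those of the strands to be capped from
    the left. *)
Definition determined n l : Prop := forall F1 F2,
  chain l n F1 -> chain l n F2 ->
  eqn n (F1 0) (F2 0) -> eqn (wfrom n l (size l)) (F1 (size l)) (F2 (size l)) ->
  forall k, k <= size l -> eqn (wfrom n l k) (F1 k) (F2 k).

(* Existence of the interior colors, given those on both ends. *)
Definition transfers n l r : Prop := forall F, chain l n F -> exists F',
  [/\ chain r n F', eqn n (F' 0) (F 0)
    & eqn (wfrom n l (size l)) (F' (size r)) (F (size l))].

Definition no_cup q := if q is Cup _ then false else true.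
Definition no_cap q := if q is Cap _ then false else true.

Lemma determined_fwd n l : okfrom n l -> all no_cup l -> determined n l.
Proof.
move=> okl nc F1 F2 h1 h2 e _; elim=> [|k IH] hk; first by rewrite wfrom0.
rewrite wfromS //; apply: (layer_fwd (okl k hk) _ (h1 k hk) (h2 k hk)); last by apply: IH; lia.
by have := elimT (all_nthP pdefault) nc k hk; case: nth => //=; auto.
Qed.

Lemma determined_bwd n l : okfrom n l -> all no_cap l -> determined n l.
Proof.
move=> okl nc F1 F2 h1 h2 _ e k hk; have [m em] : {m | m = size l - k} by exists (size l - k).
elim: m k hk em => [|m IH] k hk em.
  by have -> : k = size l by lia.
have hk' : k < size l by lia.
apply: (layer_bwd (okl k hk') _ (h1 k hk') (h2 k hk')).
  by have := elimT (all_nthP pdefault) nc k hk'; case: nth.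
by rewrite -wfromS //; apply: IH; lia.
Qed.

Definition F3 x z y : nat -> nat -> C :=
  fun k => if k is 0 then x else if k is 1 then z else y.
Definition F4 x z z' y : nat -> nat -> C :=
  fun k => match k with 0 => x | 1 => z | 2 => z' | _ => y end.

End Layers.

(** * Local moves *)

Section Far.
Variables (C : symquandle) (p q : piece) (n : nat).
Hypothesis far : pidx p + pout p <= pidx q.
Let q' := setidx q (pidx q - pout p + pin p).

Lemma width_far : piece_ok p n -> piece_ok q (wd p n) ->
  wd q (wd p n) = wd p (wd q' n).
Proof.
move: far; rewrite /q'.
by case: p => [i|i|i b]; case: q => [j|j|j c] /=; lia.
Qed.

Lemma transfers_far : piece_ok p n -> piece_ok q (wd p n) ->
   transfers C n [:: p; q] [:: q'; p].
Proof.
move=> okp okq F /chain2[]; move: (F 0) (F 1) (F 2) (erefl (F 0)) (erefl (F 2)) => x z y ex ey lp lq.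
(* The slots entering [p] and those below are untouched by [q'] and keep their left color; the slots
   above are untouched by [p] and already have their right color. *)
pose z' s := if s < pidx p + pin p then x s else y (s - pin p + pout p).
exists (F3 x z' y); split; rewrite -?ex -?ey //.
have [lop hip cop] := lp; have [loq hiq coq] := lq.
have xz s : pidx p + pin p <= s -> s < n -> z (s - pin p + pout p) = x s.
  by move=> h1 h2; apply: hip => //; lia.
have xz' s : s < pidx q' -> z' s = x s.
  rewrite /z' /q' => hs; case: ifPn => // h.
  rewrite loq; first by apply: xz; move: hs okp okq; rewrite /q'; case: (p) h (far); case: (q) => /=; lia.
  by move: hs h; case: (q) => /=; lia.
apply/chain2; split; rewrite /F3 /=; split.
- exact: xz'.
- move=> s s' h1 h2 h3; rewrite /z' ifF; last first.
    by move: h1 h3 far; rewrite /q'; case: (q) => /=; lia.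
  rewrite -xz //; last by move: h1 far; rewrite /q'; case: (q) => /=; lia.
  apply: hiq.
  + by move: h1 far; rewrite /q'; case: (q) => /=; lia.
  + by move: h1 h2 okp far; rewrite /q'; case: (q); case: (p) => /=; lia.
  + by move: h1 h2 h3 okp far; rewrite /q'; case: (q); case: (p) => /=; lia.
- have z'E s t : pidx p + pin p <= s -> t + pin p = s + pout p -> z' s = y t.
    by move=> h1 h2; rewrite /z' ifF; [congr y|]; lia.
  move: coq okp okq far; rewrite /q' {lq loq hiq xz'}.
  case: (q) => [j|j|j b] /= co okp okq f; set j' := j - pout p + pin p.
  + by rewrite (z'E j' j) ?(z'E j'.+1 j.+1) //; lia.
  + by rewrite -(hip j' j) -?(hip j'.+1 j.+1) // /j'; move: okp okq f; case: (p) => /=; lia.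
  + rewrite (z'E j' j) ?(z'E j'.+1 j.+1); try lia.
    by rewrite -(hip j' j) -?(hip j'.+1 j.+1) // /j'; move: okp okq f; case: (p) => /=; lia.
- move=> s hs; rewrite /z' ifT ?loq ?lop //; move: hs far; lia.
- move=> s s' h1 h2 h3; rewrite /z' ifF; last by lia.
  by congr y; lia.
- move: cop loq far; rewrite /z'; case: (p) => [i|i|i b] /= co lo f.
  + by rewrite !lo //; lia.
  + by rewrite !ifT //; lia.
  + by case: b co => co; rewrite !ifT ?lo //; lia.
Qed.

Lemma transfers_far_rev : piece_ok q' n -> piece_ok p (wd q' n) ->
   transfers C n [:: q'; p] [:: p; q].
Proof.
move=> okq okp F /chain2[]; move: (F 0) (F 1) (F 2) (erefl (F 0)) (erefl (F 2)) => x z' y ex ey lq lp.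
(* Here [p] comes first: the lower slots already have their right color, the upper ones still have
   their left color, up to the shift caused by [p]. *)
pose z s := if s < pidx p + pout p then y s else x (s - pout p + pin p).
exists (F3 x z y); split; rewrite -?ex -?ey //.
have [lop hip cop] := lp; have [loq hiq coq] := lq.
have okpn : piece_ok p n.
  by move: okp okq far; rewrite /q'; case: (p); case: (q) => /=; lia.
have yz s : pidx p + pout p <= s -> s - pout p + pin p < wd q' n -> z' (s - pout p + pin p) = y s.
  by move=> h1 h2; symmetry; apply: hip => //; lia.
have yx s : s < pidx q -> pidx p + pout p <= s -> y s = x (s - pout p + pin p).
  move=> h1 h2; rewrite -yz //; first by apply: loq; rewrite /q'; case: (q) h1 => /=; lia.
  by move: okq okp h1 h2; rewrite /q'; case: (p); case: (q) => /=; lia.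
apply/chain2; split; rewrite /F3 /=; split.
- move=> s hs; rewrite /z ifT; last by lia.
  by rewrite lop // loq // /q'; move: far; case: (q) => /=; lia.
- move=> s s' h1 h2 h3; rewrite /z ifF; last by lia.
  by congr x; lia.
- move: cop loq far; rewrite /z /q'; case: (p) => [i|i|i b] /= co lo f.
  + by rewrite !ifT //; lia.
  + by rewrite -!lo //; case: (q) f => /=; lia.
  + by case: b co => co; rewrite !ifT -?lo //; case: (q) f => /=; lia.
- move=> s hs; rewrite /z; case: ifPn => // h; apply: yx => //; lia.
- move=> s s' h1 h2 h3; rewrite /z ifF; last by move: far; lia.
  rewrite -yz.
  + apply: hiq.
    * by move: h1 far; rewrite /q'; case: (q) => /=; lia.
    * by move: h1 h2 okpn far; rewrite /q'; case: (q); case: (p) => /=; lia.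
    * by move: h1 h2 h3 okpn far; rewrite /q'; case: (q); case: (p) => /=; lia.
  + by move: h1 h2 h3 far; rewrite /q'; case: (q) => /=; lia.
  + by move: h1 h2 h3 okpn okq far; rewrite /q'; case: (q); case: (p) => /=; lia.
- have zE s t : pidx p + pin p <= s -> t + pin p = s + pout p -> z t = x s.
    by move=> h1 h2; rewrite /z ifF; [congr x|]; lia.
  move: coq hip okpn okq okp far; rewrite /q' {lq lp yz lop cop loq hiq yx}.
  case: (q) => [j|j|j b] /= co hip okn okq okp f; set j' := j - pout p + pin p.
  + by rewrite (hip j' j) ?(hip j'.+1 j.+1) // /j'; move: okp okn okq f; case: (p) => /=; lia.
  + by rewrite (zE j' j) ?(zE j'.+1 j.+1) //; lia.
  + rewrite (zE j' j) ?(zE j'.+1 j.+1); try lia.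
    by rewrite (hip j' j) ?(hip j'.+1 j.+1) // /j'; move: okp okn okq f; case: (p) => /=; lia.
Qed.

Lemma determined_far : piece_ok p n -> piece_ok q (wd p n) -> determined C n [:: p; q].
Proof.
move=> okp okq F1 F2 /chain2[[_ h1 _] [l1 _ _]] /chain2[[_ h2 _] [l2 _ _]] e0 e1 [|[|[|k]]] //= _ s hs.
have [h|h] := ltnP s (pidx p + pout p).
- rewrite -l1; last by move: far h; lia.
  rewrite -l2; last by move: far h; lia.
  apply: e1; move: h hs far okq; rewrite /wfrom /=; case: (q) => /=; lia.
- move: hs; rewrite /wfrom /= => hs.
  rewrite (h1 (s - pout p + pin p)); try (by move: hs h okp; case: (p) => /=; lia).
  rewrite (h2 (s - pout p + pin p)); try (by move: hs h okp; case: (p) => /=; lia).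
  by apply: e0; move: hs h okp; case: (p) => /=; lia.
Qed.

Lemma determined_far_rev : piece_ok q' n -> piece_ok p (wd q' n) -> determined C n [:: q'; p].
Proof.
move=> okq okp F1 F2 /chain2[[l1 _ _] [_ h1 _]] /chain2[[l2 _ _] [_ h2 _]] e0 e1 [|[|[|k]]] //= _ s hs.
have [h|h] := ltnP s (pidx p + pin p).
- have hs' : s < pidx q' by move: far h; rewrite /q'; case: (q) => /=; lia.
  rewrite l1 // l2 //; apply: e0; move: okq hs'; case: q' => /=; lia.
- move: hs; rewrite /wfrom /= => hs.
  rewrite -(h1 s (s - pin p + pout p)) //; try lia.
  rewrite -(h2 s (s - pin p + pout p)) //; try lia.
  apply: e1; move: hs h okp; rewrite /wfrom /=; move: (wd q' n) => m; case: (p) => /=; lia.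
Qed.

End Far.

Ltac eval_ifs := repeat (
  match goal with |- context [if ?a then _ else _] =>
    first [have -> : a = true by lia | have -> : a = false by lia] end;
  cbv beta iota); rewrite /=.

Lemma near_cases i p : p < i \/ p = i \/ p = i.+1 \/ p = i.+2 \/ i.+2 < p.
Proof. by lia. Qed.

Section Local.
Variable C : symquandle.
Implicit Types (x y z : nat -> C).

(** This is the slice to the right of a cup and equally the slice to the left of a cap; [c] is the
    only free color. *)
Definition ins i (c : C) x : nat -> C :=
  fun p => if p < i then x p else if p == i then c
           else if p == i.+1 then tau c else x p.-2.

Lemma ins_cup i c n x : layer (Cup i) n x (ins i c x).
Proof.
split=> /=; rewrite /ins.
- by move=> p hp; eval_ifs.
- by move=> p p' h1 h2 h3; rewrite (_ : p' = p.+2); [eval_ifs|lia].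
- by eval_ifs.
Qed.

Lemma ins_cap i c n x : layer (Cap i) n (ins i c x) x.
Proof.
split=> /=; rewrite /ins.
- by move=> p hp; eval_ifs.
- by move=> p p' h1 h2 h3; rewrite (_ : p = p'.+2); [eval_ifs|lia].
- by eval_ifs.
Qed.

Lemma layer_cupE i n x y : i <= n -> layer (Cup i) n x y -> eqn n.+2 y (ins i (y i) x).
Proof.
move=> hi [/= lo hh co] p hp; rewrite /ins.
case: ifPn => [/lo //|h1]; case: eqP => [-> //|h2]; case: eqP => [-> //|h3].
by apply: hh; lia.
Qed.

Lemma layer_capE i n x y : i.+2 <= n -> layer (Cap i) n y x -> eqn n y (ins i (y i) x).
Proof.
move=> hi [/= lo hh co] p hp; rewrite /ins.
case: ifPn => [/lo //|h1]; case: eqP => [-> //|h2]; case: eqP => [-> //|h3].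
by symmetry; apply: hh; lia.
Qed.

Lemma insE_cap i c n x y : i.+2 <= n -> eqn n y (ins i c x) -> layer (Cap i) n y x.
Proof. by move=> hi e; apply: layer_congr (ins_cap i c n x) => //; exact: eqn_sym. Qed.

Lemma ins_congr i c n x x' : i <= n -> eqn n x x' -> eqn n.+2 (ins i c x) (ins i c x').
Proof.
move=> hi e p hp; rewrite /ins; case: ifPn => h1; first by apply: e; lia.
by case: eqP => // h2; case: eqP => // h3; apply: e; lia.
Qed.

(** New color of a cup pulled across a strand of color [a]: the cup keeps [c] if it lies over the
    strand, and otherwise is acted on by the inverse operator of [a]. *)
Definition slide (b : bool) (a c : C) := if b then c else tri c (tau a).

Lemma crs_ins_slide i b c x p :
  crs i b (ins i.+1 c x) p = crs i.+1 (~~ b) (ins i (slide b (x i) c) x) p.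
Proof.
have [h|[->|[->|[->|h]]]] : p < i \/ p = i \/ p = i.+1 \/ p = i.+2 \/ i.+2 < p by lia.
all: case: b; rewrite /crs /set2 /ins /slide; eval_ifs => //.
- by rewrite tauK.
- by rewrite tau_tri triKV.
Qed.

Definition slideV (b : bool) (a c : C) := if b then c else tri c a.
Lemma slideK b a c : slide b a (slideV b a c) = c.
Proof. by case: b => //=; rewrite triK. Qed.

Lemma transfers_cupslide i b n : i.+1 <= n ->
  transfers C n [:: Cup i.+1; Cr i b] [:: Cup i; Cr i.+1 (~~ b)].
Proof.
move=> hi F /chain2[l1 l2].
have e1 := layer_cupE hi l1; have e2 := layer_crsE (_ : i.+2 <= n.+2) l2.
set c := F 1 i.+1 in e1.
exists (F3 (F 0) (ins i (slide b (F 0 i) c) (F 0)) (F 2)); split=> //.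
apply/chain2; split; first exact: ins_cup.
apply: crsE_layer => //= p hp; rewrite e2 //; last by lia.
by rewrite -crs_ins_slide; apply: (crs_congr _ (n:=n.+2)) => //; lia.
Qed.

Lemma transfers_cupslide_rev i b n : i.+1 <= n ->
  transfers C n [:: Cup i; Cr i.+1 (~~ b)] [:: Cup i.+1; Cr i b].
Proof.
move=> hi F /chain2[l1 l2].
have hi' : i <= n by lia.
have e1 := layer_cupE hi' l1; have e2 := layer_crsE (_ : i.+3 <= n.+2) l2.
set c := F 1 i in e1.
exists (F3 (F 0) (ins i.+1 (slideV b (F 0 i) c) (F 0)) (F 2)); split=> //.
apply/chain2; split; first exact: ins_cup.
apply: crsE_layer => /= [|p hp]; first by lia.
rewrite e2 //.
by rewrite crs_ins_slide slideK; apply: (crs_congr _ (n:=n.+2)) => //; lia.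
Qed.

Lemma crs_swap i b n x y : i.+2 <= n -> eqn n y (crs i b x) -> eqn n x (crs i (~~ b) y).
Proof.
move=> hi e p hp; rewrite -(crs_invl i b x); symmetry.
exact: (crs_congr _ (n:=n)).
Qed.

Lemma transfers_capslide i b n : i.+3 <= n ->
  transfers C n [:: Cr i b; Cap i.+1] [:: Cr i.+1 (~~ b); Cap i].
Proof.
move=> hi F /chain2[l1 l2].
have e1 := crs_swap _ (layer_crsE _ l1); have e2 := layer_capE hi l2.
set c := F 1 i.+1 in e2; set c' := slide (~~ b) (F 2 i) c.
exists (F3 (F 0) (ins i c' (F 2)) (F 2)); split=> //.
apply/chain2; split; last exact: ins_cap.
apply: crsE_layer => //=; rewrite -[X in crs _ X](negbK (~~ b)); apply: crs_swap => // p hp.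
rewrite e1 //; try lia.
by rewrite -[in RHS]crs_ins_slide; apply: (crs_congr _ (n:=n)) => //; lia.
Qed.

Lemma transfers_capslide_rev i b n : i.+3 <= n ->
  transfers C n [:: Cr i.+1 (~~ b); Cap i] [:: Cr i b; Cap i.+1].
Proof.
move=> hi F /chain2[l1 l2].
have hi' : i.+2 <= n by lia.
have e1 := crs_swap _ (layer_crsE _ l1); have e2 := layer_capE hi' l2.
set c := F 1 i in e2; set c' := slideV (~~ b) (F 2 i) c.
exists (F3 (F 0) (ins i.+1 c' (F 2)) (F 2)); split=> //.
apply/chain2; split; last exact: ins_cap.
apply: crsE_layer => //=; rewrite -[X in crs _ X](negbK b); apply: crs_swap => // p hp.
rewrite e1 //.
by rewrite crs_ins_slide slideK; apply: (crs_congr _ (n:=n)) => //; lia.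
Qed.

(** The hypothesis leaves the six sign patterns in which the strands are stacked. The bottom strand
    passes under the two others, and the two orders of doing so agree by self-distributivity, up to
    cancelling operators with their inverses. *)
Lemma crs_R3 i b1 b2 b3 x p : ~~ ((b1 == b3) && (b2 != b1)) ->
  crs i b3 (crs i.+1 b2 (crs i b1 x)) p = crs i.+1 b1 (crs i b2 (crs i.+1 b3 x)) p.
Proof.
move=> hb.
have [h|[->|[->|[->|h]]]] : p < i \/ p = i \/ p = i.+1 \/ p = i.+2 \/ i.+2 < p by lia.
all: case: b1 hb; case: b2; case: b3 => //= _; rewrite /crs /set2 /=; eval_ifs => //.
all: rewrite ?tau_tri //.
all: by [rewrite ?tauK ?triK ?triKV | rewrite tri_dist ?triK ?triKV | rewrite -tri_dist
  | rewrite [RHS]tri_dist ?triKV].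
Qed.

Lemma transfers_R3 i b1 b2 b3 n : i.+3 <= n -> ~~ ((b1 == b3) && (b2 != b1)) ->
  transfers C n [:: Cr i b1; Cr i.+1 b2; Cr i b3] [:: Cr i.+1 b3; Cr i b2; Cr i.+1 b1].
Proof.
move=> hi hb F /chain3[/= l1 l2 l3].
have hi' : i.+2 <= n by lia.
have e1 := layer_crsE hi' l1; have e2 := layer_crsE hi l2; have e3 := layer_crsE hi' l3.
exists (F4 (F 0) (crs i.+1 b3 (F 0)) (crs i b2 (crs i.+1 b3 (F 0))) (F 3)); split=> //.
apply/chain3; split; [exact: layer_crs|exact: layer_crs|].
apply: crsE_layer => // p hp; rewrite /= -crs_R3 // e3 //.
apply: (crs_congr _ (n:=n)) => // r hr; rewrite e2 //.
exact: (crs_congr _ (n:=n)).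
Qed.

Lemma transfers_R3_rev i b1 b2 b3 n : i.+3 <= n -> ~~ ((b1 == b3) && (b2 != b1)) ->
  transfers C n [:: Cr i.+1 b3; Cr i b2; Cr i.+1 b1] [:: Cr i b1; Cr i.+1 b2; Cr i b3].
Proof.
move=> hi hb F /chain3[/= l1 l2 l3].
have hi' : i.+2 <= n by lia.
have e1 := layer_crsE hi l1; have e2 := layer_crsE hi' l2; have e3 := layer_crsE hi l3.
exists (F4 (F 0) (crs i b1 (F 0)) (crs i.+1 b2 (crs i b1 (F 0))) (F 3)); split=> //.
apply/chain3; split; [exact: layer_crs|exact: layer_crs|].
apply: crsE_layer => // p hp; rewrite /= crs_R3 // e3 //.
apply: (crs_congr _ (n:=n)) => // r hr; rewrite e2 //.
exact: (crs_congr _ (n:=n)).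
Qed.

(* The word [l] acts as the identity, with a unique interior coloring. *)
Definition rigid n l : Prop := exists Z : (nat -> C) -> nat -> nat -> C,
  [/\ forall F, chain l n F -> forall k, k <= size l -> eqn (wfrom n l k) (F k) (Z (F 0) k),
      forall x, chain l n (Z x),
      forall x, Z x 0 = x /\ Z x (size l) = x
    & forall x x' k, k <= size l -> eqn n x x' -> eqn (wfrom n l k) (Z x k) (Z x' k)].

Lemma rigid_transfers n l : wfrom n l (size l) = n -> rigid n l -> transfers C n l [::].
Proof.
move=> hw [Z [h1 h2 h3 _]] F hF; exists (fun _ => F 0); split=> //.
have := h1 F hF _ (leqnn _); rewrite (h3 (F 0)).2; exact: eqn_sym.
Qed.

Lemma rigid_transfers_rev n l : rigid n l -> transfers C n [::] l.
Proof.
move=> [Z [_ h2 h3 _]] F _; exists (Z (F 0)).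
by rewrite (h3 (F 0)).1 (h3 (F 0)).2; split.
Qed.

Lemma rigid_determined n l : rigid n l -> determined C n l.
Proof.
move=> [Z [h1 _ _ h4]] F1 F2 c1 c2 e _ k hk p hp.
by rewrite h1 // (h4 _ _ _ hk e) // -h1.
Qed.

Lemma determined_nil n : determined C n [::].
Proof. by move=> F1 F2 _ _ e _ [|k]. Qed.

Lemma rigid_R2 i b n : i.+2 <= n -> rigid n [:: Cr i b; Cr i (~~ b)].
Proof.
move=> hi; exists (fun x => F3 x (crs i b x) x); split=> //.
- move=> F /chain2[/= l1 l2] [|[|[|k]]] //= _; rewrite /wfrom /=; first exact: layer_crsE.
  move=> p hp; rewrite (layer_crsE _ l2) // -[RHS](crs_invl i b).
  apply: (crs_congr _ (n:=n)) => //; exact: layer_crsE.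
- move=> x; apply/chain2; split; first exact: layer_crs.
  by apply: crsE_layer => // p hp; rewrite crs_invl.
- move=> x x' [|[|[|k]]] //= _ e; exact: crs_congr.
Qed.

(** The zigzag reverses the reading direction twice, so the color returns by [tauK], and the free
    color of the cup is forced. *)
Lemma rigid_snake1 i n : i.+1 <= n -> rigid n [:: Cup i; Cap i.+1].
Proof.
move=> hi; exists (fun x => F3 x (ins i (x i) x) x); split=> //.
- move=> F /chain2[/= l1 l2].
  have hi' : i <= n by lia.
  have e1 := layer_cupE hi' l1; have e2 := layer_capE (_ : i.+3 <= n.+2) l2.
  have {}e2 := e2 hi; set c := F 1 i in e1; set c' := F 1 i.+1 in e2.
  have E p : p < n.+2 -> ins i c (F 0) p = ins i.+1 c' (F 2) p.
    by move=> hp; rewrite -e1 // e2.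
  have c'E : c' = tau c by rewrite /c' e1; [rewrite /ins; eval_ifs|lia].
  have cE : c = F 0 i.
    by have := E i.+2; rewrite c'E /ins; eval_ifs => -> //; rewrite tauK.
  move=> [|[|[|k]]] //= _; first by rewrite -cE.
  rewrite /wfrom /= => p hp; have [h|[->|h]] : p < i \/ p = i \/ i < p by lia.
  + by have := E p; rewrite /ins; eval_ifs => -> //; lia.
  + by have := E i; rewrite /ins -cE; eval_ifs => -> //; lia.
  + by have := E p.+2; rewrite /ins; eval_ifs => -> //; lia.
- move=> x; apply/chain2; split; first exact: ins_cup.
  apply: (insE_cap (c := tau (x i))) => //= p hp.
  by have [h|[->|[->|[->|h]]]] := near_cases i p; rewrite /ins; eval_ifs; rewrite ?tauK.
- move=> x x' [|[|[|k]]] //= _ e; rewrite e //; apply: (@ins_congr _ _ n) => //; lia.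
Qed.

Lemma rigid_snake2 i n : i.+1 <= n -> rigid n [:: Cup i.+1; Cap i].
Proof.
move=> hi; exists (fun x => F3 x (ins i.+1 (tau (x i)) x) x); split=> //.
- move=> F /chain2[/= l1 l2].
  have hi' : i.+2 <= n.+2 by lia.
  have e1 := layer_cupE hi l1; have e2 := layer_capE hi' l2.
  set c := F 1 i.+1 in e1; set c' := F 1 i in e2.
  have E p : p < n.+2 -> ins i.+1 c (F 0) p = ins i c' (F 2) p.
    by move=> hp; rewrite -e1 // e2.
  have c'E : c' = F 0 i by rewrite /c' e1; [rewrite /ins; eval_ifs|lia].
  have cE : c = tau (F 0 i).
    by have := E i.+1; rewrite c'E /ins; eval_ifs => -> //; lia.
  move=> [|[|[|k]]] //= _; first by rewrite -cE.
  rewrite /wfrom /= => p hp; have [h|[->|h]] : p < i \/ p = i \/ i < p by lia.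
  + by have := E p; rewrite /ins; eval_ifs => -> //; lia.
  + by have := E i.+2; rewrite /ins cE; eval_ifs; rewrite tauK => -> //; lia.
  + by have := E p.+2; rewrite /ins; eval_ifs => -> //; lia.
- move=> x; apply/chain2; split; first exact: ins_cup.
  apply: (insE_cap (c := x i)) => /= [|p hp]; first by lia.
  by have [h|[->|[->|[->|h]]]] := near_cases i p; rewrite /ins; eval_ifs; rewrite ?tauK.
- move=> x x' [|[|[|k]]] //= _ e; rewrite e //; apply: (@ins_congr _ _ n) => //; lia.
Qed.

(** The arc of the kink must have the color of the strand: either it is the same strand passing
    over, or it satisfies [c = tri (F 0 i) c], and cancelling the operator of [c] gives [c = F 0 i]
    by idempotence. Idempotence also makes the kink close up. *)
Lemma rigid_R1a i b n : i.+1 <= n -> rigid n [:: Cup i.+1; Cr i b; Cap i.+1].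
Proof.
move=> hi; pose z1 x := ins i.+1 (x i) x.
exists (fun x => F4 x (z1 x) (crs i b (z1 x)) x); split=> //.
- move=> F /chain3[/= l1 l2 l3].
  have e1 := layer_cupE hi l1; have e2 := layer_crsE (_ : i.+2 <= n.+2) l2.
  have {}e2 := e2 (ltnW hi).
  have e3 := layer_capE (_ : i.+3 <= n.+2) l3; have {}e3 := e3 hi.
  set c := F 1 i.+1 in e1; set c' := F 2 i.+1 in e3.
  have e12 : eqn n.+2 (F 2) (crs i b (ins i.+1 c (F 0))).
    by move=> p hp; rewrite e2 //; apply: (crs_congr _ (n:=n.+2)) => //; lia.
  have E p : p < n.+2 -> crs i b (ins i.+1 c (F 0)) p = ins i.+1 c' (F 3) p.
    by move=> hp; rewrite -e12 // e3.
  have c'E : c' = if b then tri (F 0 i) c else F 0 i.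
    by rewrite /c' e12; try lia; rewrite /crs /set2 /ins; case: (b); eval_ifs.
  have cE : c = F 0 i.
    have := E i.+2; rewrite c'E /crs /set2 /ins; case: (b); eval_ifs.
    + move=> h; have {}h : c = tri (F 0 i) c by apply: tau_inj; apply: h; lia.
      by rewrite -(triK (F 0 i) c) -h tri_tau_id.
    + by move=> h; apply: tau_inj; apply: h; lia.
  rewrite cE in e1 e12 E; rewrite cE in c'E.
  move=> [|[|[|[|k]]]] //= _.
  rewrite /wfrom /= => p hp; have [h|[->|h]] : p < i \/ p = i \/ i < p by lia.
  + by have := E p; rewrite /crs /set2 /ins; case: (b); eval_ifs => -> //; lia.
  + by have := E i; rewrite /crs /set2 /ins; case: (b); eval_ifs; rewrite ?tri_tau_id => -> //; lia.
  + by have := E p.+2; rewrite /crs /set2 /ins; case: (b); eval_ifs => -> //; lia.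
- move=> x; apply/chain3; split; [exact: ins_cup|exact: layer_crs|].
  apply: (insE_cap (c := x i)) => //= p hp.
  by have [h|[->|[->|[->|h]]]] := near_cases i p; case: b; rewrite /z1 /crs /set2 /ins; eval_ifs; rewrite ?tri_id ?tri_tau_id.
- have zc x x' : eqn n x x' -> eqn n.+2 (z1 x) (z1 x').
    by move=> e; rewrite /z1 e //; apply: ins_congr.
  by move=> x x' [|[|[|[|k]]]] //= _ e; [exact: zc|apply: (crs_congr _ (n:=n.+2)) => //; [lia|exact: zc]].
Qed.

Lemma rigid_R1b i b n : i.+1 <= n -> rigid n [:: Cup i; Cr i.+1 b; Cap i].
Proof.
move=> hi; pose z1 x := ins i (tau (x i)) x.
have hi' : i <= n by lia.
exists (fun x => F4 x (z1 x) (crs i.+1 b (z1 x)) x); split=> //.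
- move=> F /chain3[/= l1 l2 l3].
  have e1 := layer_cupE hi' l1; have e2 := layer_crsE (_ : i.+3 <= n.+2) l2.
  have {}e2 := e2 hi.
  have e3 := layer_capE (_ : i.+2 <= n.+2) l3; have {}e3 := e3 hi'.
  set c := F 1 i in e1; set c' := F 2 i in e3.
  have e12 : eqn n.+2 (F 2) (crs i.+1 b (ins i c (F 0))).
    by move=> p hp; rewrite e2 //; apply: (crs_congr _ (n:=n.+2)) => //; lia.
  have E p : p < n.+2 -> crs i.+1 b (ins i c (F 0)) p = ins i c' (F 3) p.
    by move=> hp; rewrite -e12 // e3.
  have c'E : c' = c.
    by rewrite /c' e12; try lia; rewrite /crs /set2 /ins; case: (b); eval_ifs.
  have cE : c = tau (F 0 i).
    have := E i.+1; rewrite c'E /crs /set2 /ins; case: (b); eval_ifs.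
    + by move=> ->; [rewrite tauK|lia].
    + move=> h; rewrite tauK in h.
      by rewrite -(triK (F 0 i) c) h ?tri_tau_id ?tri_id ?tauK //; lia.
  rewrite cE in e1 e12 E; rewrite cE in c'E.
  move=> [|[|[|[|k]]]] //= _.
  rewrite /wfrom /= => p hp; have [h|[->|h]] : p < i \/ p = i \/ i < p by lia.
  + by have := E p; rewrite /crs /set2 /ins; case: (b); eval_ifs => -> //; lia.
  + by have := E i.+2; rewrite /crs /set2 /ins; case: (b); eval_ifs; rewrite ?tauK ?tri_id ?tri_tau_id => -> //; lia.
  + by have := E p.+2; rewrite /crs /set2 /ins; case: (b); eval_ifs => -> //; lia.
- move=> x; apply/chain3; split; [exact: ins_cup|exact: layer_crs|].
  apply: (insE_cap (c := tau (x i))) => //= p hp.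
  by have [h|[->|[->|[->|h]]]] := near_cases i p; case: b; rewrite /z1 /crs /set2 /ins; eval_ifs; rewrite ?tauK ?tri_id ?tri_tau_id.
- have zc x x' : eqn n x x' -> eqn n.+2 (z1 x) (z1 x').
    by move=> e; rewrite /z1 e //; apply: ins_congr.
  by move=> x x' [|[|[|[|k]]]] //= _ e; [exact: zc|apply: (crs_congr _ (n:=n.+2)) => //; exact: zc].
Qed.

End Local.

(* [lstep n l k p k' p']: strand [p] of slice [k] continues as strand [p'] of slice [k']. *)
Inductive lstep n l : nat -> nat -> nat -> nat -> Prop :=
  | LNext k p p' : k < size l -> p < wfrom n l k ->
      nxt (nth pdefault l k) p = Some p' -> lstep n l k p k.+1 p'
  | LCup k i : k < size l -> nth pdefault l k = Cup i -> lstep n l k.+1 i k.+1 i.+1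
  | LCap k i : k < size l -> nth pdefault l k = Cap i -> lstep n l k i k i.+1.

(** A component lying entirely inside the word would have no exit, and twists on it could not be
    slid out. *)
Inductive exits n l : nat -> nat -> Prop :=
  | ExitL p : exits n l 0 p
  | ExitR p : exits n l (size l) p
  | ExitFwd k p k' p' : lstep n l k p k' p' -> exits n l k' p' -> exits n l k p
  | ExitBwd k p k' p' : lstep n l k' p' k p -> exits n l k' p' -> exits n l k p.

Definition exiting n l : Prop :=
  forall k p, k <= size l -> p < wfrom n l k -> exits n l k p.

Lemma exiting_nil n : exiting n [::].
Proof. by move=> [|k] p // _ _; exact: ExitL. Qed.

Lemma exiting_fwd n l : okfrom n l -> all no_cup l -> exiting n l.
Proof.
move=> okl nc k; elim: k => [|k IH] p hk hp; first exact: ExitL.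
have := elimT (all_nthP pdefault) nc k hk.
move: hp; rewrite wfromS //.
have := okl k hk; set m := wfrom n l k; case e: (nth pdefault l k) => [i|i|i b] //= okk hp _.
- pose p' := if p < i then p else p.+2.
  have hp' : p' < m by rewrite /p'; case: ifP; lia.
  apply: (@ExitBwd _ _ _ _ k p'); last by apply: IH; [lia|].
  apply: LNext => //.
  by rewrite e /= /p'; case: (ltnP p i) => h /=; [rewrite h|rewrite !ifF; try lia; congr Some; lia].
- pose p' := if p == i then i.+1 else if p == i.+1 then i else p.
  have hp' : p' < m by rewrite /p'; case: ifP; [|case: ifP]; lia.
  apply: (@ExitBwd _ _ _ _ k p'); last by apply: IH; [lia|].
  apply: LNext => //.
  rewrite e /= /p'; congr Some; case: (eqVneq p i) => [->|h1].
    by rewrite ifF ?eqxx //; lia.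
  by case: (eqVneq p i.+1) => [->|h2]; rewrite ?eqxx // !ifF //; lia.
Qed.

Lemma exiting_bwd n l : okfrom n l -> all no_cap l -> exiting n l.
Proof.
move=> okl nc k p hk; have [m em] : {m | m = size l - k} by exists (size l - k).
elim: m k p hk em => [|m IH] k p hk em hp.
  by have -> : k = size l; [lia|exact: ExitR].
have hk' : k < size l by lia.
have := elimT (all_nthP pdefault) nc k hk'; have := okl k hk'.
have := @IH k.+1; rewrite wfromS // => {}IH.
case e: (nth pdefault l k) IH => [i|i|i b] IH //= okk _.
- pose p' := if p < i then p else p.+2.
  apply: (@ExitFwd _ _ _ _ k.+1 p'); last first.
    by apply: IH; [lia|lia|rewrite /p' /=; repeat case: ifP; lia].
  by apply: LNext => //; rewrite e.
- pose p' := if p == i then i.+1 else if p == i.+1 then i else p.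
  apply: (@ExitFwd _ _ _ _ k.+1 p'); last first.
    by apply: IH; [lia|lia|rewrite /p' /=; repeat case: ifP; lia].
  by apply: LNext => //; rewrite e.
Qed.

Section Exits2.
Variables (n : nat) (p q : piece).

Lemma exits_left s s' : s < n -> nxt p s = Some s' -> exits n [:: p; q] 1 s'.
Proof. by move=> hs e; apply: (@ExitBwd _ _ _ _ 0 s); [apply: LNext|exact: ExitL]. Qed.

Lemma exits_right s s' : s < wd p n -> nxt q s = Some s' -> exits n [:: p; q] 1 s.
Proof. by move=> hs e; apply: (@ExitFwd _ _ _ _ 2 s'); [apply: LNext|exact: ExitR]. Qed.

Lemma exiting2 : (forall s, s < wd p n -> exits n [:: p; q] 1 s) -> exiting n [:: p; q].
Proof. by move=> h [|[|[|k]]] s //= _ hs; [exact: ExitL|apply: h|exact: ExitR]. Qed.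

End Exits2.

Lemma nxt_lo q s : s < pidx q -> nxt q s = Some s.
Proof. by case: q => [i|i|i b] /= h; rewrite ?h // !ifF //; lia. Qed.

Lemma nxt_hi q s s' : pidx q + pin q <= s -> s' + pin q = s + pout q -> nxt q s = Some s'.
Proof.
by case: q => [i|i|i b] /= h e; rewrite !ifF; try lia; congr Some; lia.
Qed.

Lemma exiting_far p q n : pidx p + pout p <= pidx q -> piece_ok p n -> piece_ok q (wd p n) ->
  exiting n [:: p; q].
Proof.
move=> far okp okq; apply: exiting2 => s hs; have [h|h] := ltnP s (pidx p + pout p).
- by apply: exits_right; [|apply: nxt_lo; lia].
- apply: (@exits_left _ _ _ (s - pout p + pin p)).
    by move: hs h okp; case: (p) => /=; lia.
  by apply: nxt_hi; lia.
Qed.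

Lemma exiting_far_rev p q n (q' := setidx q (pidx q - pout p + pin p)) :
  pidx p + pout p <= pidx q -> piece_ok q' n -> piece_ok p (wd q' n) ->
  exiting n [:: q'; p].
Proof.
move=> far okq okp; apply: exiting2 => s hs; have [h|h] := ltnP s (pidx p + pin p).
- have hs' : s < pidx q' by rewrite /q'; move: far h; case: (q) => /=; lia.
  apply: (@exits_left _ _ _ s); last exact: nxt_lo.
  by move: hs' okq; case: (q') => /=; lia.
- by apply: (@exits_right _ _ _ _ (s - pin p + pout p)) => //; apply: nxt_hi; lia.
Qed.

Lemma exiting_snake1 i n : i.+1 <= n -> exiting n [:: Cup i; Cap i.+1].
Proof.
move=> hi; apply: exiting2 => s /= hs.
have ei : exits n [:: Cup i; Cap i.+1] 1 i by apply: (exits_right (s' := i)) => /=; [lia|rewrite ltnSn].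
have [h|[->|[->|h]]] : s < i \/ s = i \/ s = i.+1 \/ i.+2 <= s by lia.
- by apply: (exits_left _ (s := s)) => /=; [lia|rewrite h].
- exact: ei.
- by apply: ExitBwd ei; apply: LCup.
- by apply: (exits_left _ (s := s.-2)) => /=; [lia|rewrite ifF; [congr Some|]; lia].
Qed.

Lemma exiting_snake2 i n : i.+1 <= n -> exiting n [:: Cup i.+1; Cap i].
Proof.
move=> hi; apply: exiting2 => s /= hs.
have ei : exits n [:: Cup i.+1; Cap i] 1 i.+2 by apply: (exits_right (s' := i)) => //=; rewrite !ifF; [congr Some|..]; lia.
have [h|[->|[->|h]]] : s < i.+1 \/ s = i.+1 \/ s = i.+2 \/ i.+3 <= s by lia.
- by apply: (exits_left _ (s := s)) => /=; [lia|rewrite h].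
- by apply: ExitFwd ei; apply: LCup.
- exact: ei.
- by apply: (exits_left _ (s := s.-2)) => /=; [lia|rewrite ifF; [congr Some|]; lia].
Qed.

Lemma exiting3 p c q n :
  (forall s, s < wd p n -> exits n [:: p; c; q] 1 s) ->
  (forall s, s < wd c (wd p n) -> exits n [:: p; c; q] 2 s) ->
  exiting n [:: p; c; q].
Proof. by move=> h1 h2 [|[|[|[|k]]]] s //= _ hs; [exact: ExitL|apply: h1|apply: h2|exact: ExitR]. Qed.

Lemma exiting_R1a i b n : i.+1 <= n -> exiting n [:: Cup i.+1; Cr i b; Cap i.+1].
Proof.
move=> hi; set l := [:: _; _; _].
have l10 s s' : s < n -> nxt (Cup i.+1) s = Some s' -> exits n l 1 s'.
  by move=> hs e; apply: (@ExitBwd _ _ _ _ 0 s); [apply: LNext|exact: ExitL].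
have r23 s s' : s < n.+2 -> nxt (Cap i.+1) s = Some s' -> exits n l 2 s.
  by move=> hs e; apply: (@ExitFwd _ _ _ _ 3 s'); [apply: (@LNext n l 2)|exact: ExitR].
have c12 s s' : s < n.+2 -> nxt (Cr i b) s = Some s' -> lstep n l 1 s 2 s'.
  by move=> hs e; apply: (@LNext n l 1).
have x2i : exits n l 2 i by apply: (r23 i i) => /=; [lia|rewrite ltnSn].
have x1i : exits n l 1 i by apply: (l10 i i) => //=; rewrite ltnSn.
have x2i1 : exits n l 2 i.+1 by apply: ExitBwd x1i; apply: c12 => /=; [lia|rewrite eqxx].
have x1i1 : exits n l 1 i.+1.
  by apply: ExitFwd x2i; apply: c12 => /=; [lia|rewrite eqxx ifF //; lia].
apply: exiting3 => s /= hs.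
- have [h|[->|[->|h]]] : s < i.+1 \/ s = i.+1 \/ s = i.+2 \/ i.+3 <= s by lia.
  + by apply: (l10 s) => /=; [lia|rewrite h].
  + by [].
  + by apply: ExitBwd x1i1; apply: (@LCup n l 0).
  + by apply: (l10 s.-2) => /=; [lia|rewrite ifF; [congr Some|]; lia].
- have [h|[->|[->|h]]] : s < i.+1 \/ s = i.+1 \/ s = i.+2 \/ i.+3 <= s by lia.
  + by apply: (r23 s s) => //=; rewrite h.
  + by [].
  + by apply: ExitBwd x2i1; apply: (@LCap n l 2).
  + by apply: (r23 s s.-2) => //=; rewrite !ifF; [congr Some|..]; lia.
Qed.

Lemma exiting_R1b i b n : i.+1 <= n -> exiting n [:: Cup i; Cr i.+1 b; Cap i].
Proof.
move=> hi; set l := [:: _; _; _].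
have l10 s s' : s < n -> nxt (Cup i) s = Some s' -> exits n l 1 s'.
  by move=> hs e; apply: (@ExitBwd _ _ _ _ 0 s); [apply: LNext|exact: ExitL].
have r23 s s' : s < n.+2 -> nxt (Cap i) s = Some s' -> exits n l 2 s.
  by move=> hs e; apply: (@ExitFwd _ _ _ _ 3 s'); [apply: (@LNext n l 2)|exact: ExitR].
have c12 s s' : s < n.+2 -> nxt (Cr i.+1 b) s = Some s' -> lstep n l 1 s 2 s'.
  by move=> hs e; apply: (@LNext n l 1).
have x2i : exits n l 2 i.+2.
  by apply: (r23 i.+2 i) => //=; rewrite !ifF; [congr Some|..]; lia.
have x1i : exits n l 1 i.+2.
  by apply: (l10 i i.+2) => //=; rewrite ltnn.
have x2i1 : exits n l 2 i.+1.
  by apply: ExitBwd x1i; apply: c12 => //=; rewrite eqxx ifF //; lia.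
have x1i1 : exits n l 1 i.+1 by apply: ExitFwd x2i; apply: c12 => /=; [lia|rewrite eqxx].
apply: exiting3 => s /= hs.
- have [h|[->|[->|h]]] : s < i \/ s = i \/ s = i.+1 \/ i.+2 <= s by lia.
  + by apply: (l10 s) => /=; [lia|rewrite h].
  + by apply: ExitFwd x1i1; apply: (@LCup n l 0).
  + by [].
  + by apply: (l10 s.-2) => /=; [lia|rewrite ifF; [congr Some|]; lia].
- have [h|[->|[->|h]]] : s < i \/ s = i \/ s = i.+1 \/ i.+2 <= s by lia.
  + by apply: (r23 s s) => //=; rewrite h.
  + by apply: ExitFwd x2i1; apply: (@LCap n l 2).
  + by [].
  + by apply: (r23 s s.-2) => //=; rewrite !ifF; [congr Some|..]; lia.
Qed.

(** The color properties are required for every symmetric quandle because invariance uses them for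
    [double_sq], to move colorings, and for [bool_sq], to identify orientations. *)
Record local_equiv n l r : Prop := LocalEquiv {
  le_width : wfrom n l (size l) = wfrom n r (size r);
  le_transfer : forall C, transfers C n l r;
  le_transfer_rev : forall C, transfers C n r l;
  le_detl : forall C, determined C n l;
  le_detr : forall C, determined C n r;
  le_exitl : exiting n l;
  le_exitr : exiting n r }.

Lemma local_equiv_sym n l r : local_equiv n l r -> local_equiv n r l.
Proof. by case=> h *; split=> //; rewrite h. Qed.

Lemma okfrom2 n p q : okfrom n [:: p; q] -> piece_ok p n /\ piece_ok q (wd p n).
Proof. by move=> h; split; [exact: (h 0 isT)|exact: (h 1 isT)]. Qed.

Lemma okfrom3 n p q r : okfrom n [:: p; q; r] ->
  [/\ piece_ok p n, piece_ok q (wd p n) & piece_ok r (wd q (wd p n))].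
Proof. by move=> h; split; [exact: (h 0 isT)|exact: (h 1 isT)|exact: (h 2 isT)]. Qed.

Lemma rigid_local_equiv n l : wfrom n l (size l) = n -> (forall C, rigid C n l) ->
  exiting n l -> local_equiv n l [::].
Proof.
move=> hw hr he; split=> // [C|C|C|C|].
- exact: rigid_transfers.
- exact: rigid_transfers_rev.
- exact: rigid_determined.
- exact: determined_nil.
- exact: exiting_nil.
Qed.

Lemma move_local_equiv n l r : move l r -> okfrom n l -> okfrom n r -> local_equiv n l r.
Proof.
case=> [p q far|i|i|i b|i b|i b|i b1 b2 b3 hb|i b|i b] okl okr.
- have [h1 h2] := okfrom2 okl; have [h3 h4] := okfrom2 okr; split.
  + exact: width_far.
  + by move=> C; apply: transfers_far.
  + by move=> C; apply: transfers_far_rev.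
  + by move=> C; apply: determined_far.
  + by move=> C; apply: determined_far_rev.
  + exact: exiting_far.
  + exact: exiting_far_rev.
- have [/= h1 h2] := okfrom2 okl.
  by apply: rigid_local_equiv => // [C|]; [apply: rigid_snake1|apply: exiting_snake1].
- have [/= h1 h2] := okfrom2 okl.
  by apply: rigid_local_equiv => // [C|]; [apply: rigid_snake2|apply: exiting_snake2].
- have [/= h1 h2 h3] := okfrom3 okl.
  by apply: rigid_local_equiv => // [C|]; [apply: rigid_R1a|apply: exiting_R1a].
- have [/= h1 h2 h3] := okfrom3 okl.
  by apply: rigid_local_equiv => // [C|]; [apply: rigid_R1b|apply: exiting_R1b].
- have [/= h1 h2] := okfrom2 okl.
  by apply: rigid_local_equiv => // [C|]; [apply: rigid_R2|apply: exiting_fwd].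
- have [/= h1 h2 h3] := okfrom3 okl; split=> //; move=> *.
  + exact: transfers_R3.
  + exact: transfers_R3_rev.
  + exact: determined_fwd.
  + exact: determined_fwd.
  + exact: exiting_fwd.
  + exact: exiting_fwd.
- have [/= h1 h2] := okfrom2 okl; split=> // [C|C|C|C||].
  + exact: transfers_capslide.
  + exact: transfers_capslide_rev.
  + exact: determined_fwd.
  + exact: determined_fwd.
  + exact: exiting_fwd.
  + exact: exiting_fwd.
- have [/= h1 h2] := okfrom2 okl; split=> // [C|C|C|C||].
  + exact: transfers_cupslide.
  + exact: transfers_cupslide_rev.
  + exact: determined_bwd.
  + exact: determined_bwd.
  + exact: exiting_bwd.
  + exact: exiting_bwd.
Qed.

(** * Twisted colorings *)

(** [qop false] inverts [qop true]. The laws of [act] are those of [u] and [d] in a GL-rack, stated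
    for a whole abelian group of twists. *)
Record twquandle (A : zmodType) (X : Type) := TwQuandle {
  qop : bool -> X -> X -> X;
  qopK : forall s x y, qop (~~ s) (qop s x y) y = x;
  qop_id : forall s x, qop s x x = x;
  qop_dist : forall s t x y z,
    qop s (qop t x y) z = qop t (qop s x z) (qop s y z);
  act : A -> X -> X;
  act0 : forall x, act 0%R x = x;
  actD : forall a b x, act (a + b)%R x = act a (act b x);
  act_opl : forall s a x y, act a (qop s x y) = qop s (act a x) y;
  act_opr : forall s a x y, qop s x (act a y) = qop s x y }.

Definition bool_sq : symquandle.
Proof.
apply: (@SymQuandle bool negb (fun a _ => a)) => //; exact: negbK.
Defined.

Definition zmod_sq (A : zmodType) : symquandle.
Proof.
apply: (@SymQuandle A (fun a => - a)%R (fun a _ => a)) => //; exact: opprK.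
Defined.

Section Twisted.
Variables (A : zmodType) (X : finType) (Q : twquandle A X).

(** The symmetric double of a quandle: the sign of a color tells whether the strand runs in the
    reading direction, and the sign of the operator chooses between the operation and its
    inverse. *)
Definition double_sq : symquandle.
Proof.
apply: (@SymQuandle (bool * X)%type (fun c => (~~ c.1, c.2))
  (fun c d => (c.1, qop Q d.1 c.2 d.2))) => [[s x]|[s x] [t y]|||] //=.
- by rewrite negbK.
- by rewrite qopK.
- by move=> [s x]; rewrite qop_id.
- by move=> [s x] [t y] [r z] /=; rewrite qop_dist.
Defined.

(** Twists are measured along the orientation; read from left to right, a twist on a strand running
    to the left is inverted. *)
Definition sg (s : bool) (a : A) : A := if s then a else (- a)%R.

Definition dact (a : A) (c : double_sq) : double_sq := (c.1, act Q (sg c.1 a) c.2).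

Lemma sgD s a b : sg s (a + b)%R = (sg s a + sg s b)%R.
Proof. by case: s => //=; rewrite opprD. Qed.

Lemma dactD a b c : dact (a + b)%R c = dact a (dact b c).
Proof. by rewrite /dact /= sgD actD. Qed.

Lemma dact0 c : dact 0%R c = c.
Proof. by case: c => [[] x]; rewrite /dact /sg /= ?oppr0 act0. Qed.

Lemma tau_dact a c : tau (dact a c) = dact (- a)%R (tau c).
Proof. by case: c => [[] x]; rewrite /dact /sg /= ?opprK. Qed.

Lemma tri_dactl a c d : tri (dact a c) d = dact a (tri c d).
Proof. by rewrite /dact /= act_opl. Qed.

Lemma tri_dactr a (c d : double_sq) : tri c (dact a d) = tri c d.
Proof. by rewrite /dact /= act_opr. Qed.

(** A conserved flow of twists passes through a piece: it commutes with the operators acting on the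
    under-strand, is invisible on the over-strand as an operator, and changes sign around a cusp. *)
Lemma layer_dact q n (x y : nat -> double_sq) (hr hl : nat -> zmod_sq A) :
  layer q n x y -> layer q n hr hl ->
  layer q n (fun p => dact (hr p) (x p)) (fun p => dact (hl p) (y p)).
Proof.
move=> [lo hi co] [lo' hi' co']; split.
- by move=> p hp; rewrite lo // lo'.
- by move=> p p' h1 h2 h3; rewrite (hi p p') // (hi' p p').
- case: q co co' {lo hi lo' hi'} => [i|i|i []]; rewrite /core.
  + by move=> -> ->; rewrite tau_dact.
  + by move=> -> ->; rewrite tau_dact.
  + by move=> [-> ->] [-> ->]; rewrite tri_dactl tri_dactr.
  + by move=> [-> ->] [-> ->]; rewrite tau_dact tri_dactl tri_dactr.
Qed.

Implicit Types (w : seq piece) (o : nat -> nat -> bool) (L R c h : nat -> nat -> A)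
  (f : nat -> nat -> X).

(* At its right (left) end, the color of a slot is seen twisted by [R] ([L]),
   in the direction of the orientation. *)
Definition face o T f k : nat -> double_sq := fun p => dact (T k p) (o k p, f k p).

Definition colored w o L R f : Prop := forall k, k < size w ->
  layer (nth pdefault w k) (wfrom 0 w k) (face o R f k) (face o L f k.+1).

Definition indom w k p : bool := (k <= size w) && (p < wfrom 0 w k).

Definition eqdom T w (f g : nat -> nat -> T) : Prop :=
  forall k p, indom w k p -> f k p = g k p.

Lemma eqdom_sym T w (f g : nat -> nat -> T) : eqdom w f g -> eqdom w g f.
Proof. by move=> h k p /h. Qed.

Lemma colored_congr w o L L' R R' f f' : okfrom 0 w -> eqdom w L L' -> eqdom w R R' ->
  eqdom w f f' -> colored w o L R f -> colored w o L' R' f'.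
Proof.
move=> okw eL eR ef h k hk; apply: layer_congr (h k hk); first exact: okw.
- by move=> p hp; rewrite /face eR ?ef // /indom hp (ltnW hk).
- move=> p; rewrite -wfromS // => hp.
  by rewrite /face eL ?ef // /indom hp hk.
Qed.

(** Recoloring a slot by the twist [- h] is compensated by adding [h] at both of its ends, so
    neither face changes. *)
Lemma colored_gauge w o L R h f : colored w o L R f ->
  colored w o (fun k p => L k p + h k p)%R (fun k p => R k p + h k p)%R
    (fun k p => act Q (sg (o k p) (- h k p)%R) (f k p)).
Proof.
move=> cf k hk; have := cf k hk; set x := face _ _ _ _; set y := face _ _ _ _ => hl.
have e T j p : face o (fun k p => T k p + h k p)%R
    (fun k p => act Q (sg (o k p) (- h k p)%R) (f k p)) j p = face o T f j p.
  rewrite /face -[in RHS](addrK (h j p) (T j p)) [in RHS]dactD.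
  by congr dact; rewrite /dact.
case: hl => lo hi co; split.
- by move=> p hp; rewrite !e; apply: lo.
- by move=> p p' h1 h2 h3; rewrite !e; apply: hi h3.
- by rewrite !e.
Qed.

Lemma colored_flow w o L R hl hr f : colored w o L R f ->
  (forall k, k < size w -> layer (C := zmod_sq A) (nth pdefault w k) (wfrom 0 w k) (hr k) (hl k.+1)) ->
  colored w o (fun k p => hl k p + L k p)%R (fun k p => hr k p + R k p)%R f.
Proof.
move=> cf fl k hk; have := layer_dact (cf k hk) (fl k hk).
rewrite /face => -[lo hi co]; split.
- by move=> p hp; rewrite !dactD lo.
- by move=> p p' h1 h2 h3; rewrite !dactD; apply: hi h3.
- by rewrite !dactD.
Qed.

(** * Counting colorings *)

Variable x0 : X.

Lemma seg_eq w (s t : seg w) : sk s = sk t -> sp s = sp t -> s = t.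
Proof.
rewrite /sk /sp; case: s t => [[k p] h] [[k' p'] h'] /= e1 e2; apply: val_inj => /=.
by congr pair; apply: val_inj.
Qed.

Lemma indom_seg w (s : seg w) : indom w (sk s) (sp s).
Proof. by rewrite /indom /sk /sp; case: s => [[k p] /= h]; rewrite -ltnS ltn_ord. Qed.

Lemma wfrom_bound w k : k <= size w -> wfrom 0 w k <= k * 2.
Proof.
elim: k => [|k IH] hk; first by rewrite wfrom0.
rewrite wfromS //; have := IH (ltnW hk).
by case: nth => [i|i|i b] /=; lia.
Qed.

Lemma seg_of w k p : indom w k p -> {s : seg w | sk s = k & sp s = p}.
Proof.
move=> /andP[hk hp]; have h1 : k < (size w).+1 by [].
have h2 : p < (2 * size w).+1 by have := wfrom_bound hk; lia.
by exists (exist (fun x : 'I_(size w).+1 * 'I_(2 * size w).+1 => x.2 < width_at w x.1)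
  (Ordinal h1, Ordinal h2) hp).
Qed.

Definition extend w (g : {ffun seg w -> X}) : nat -> nat -> X := fun k p =>
  if [pick s : seg w | (sk s == k) && (sp s == p)] is Some s then g s else x0.

Lemma extendE w (g : {ffun seg w -> X}) s : extend g (sk s) (sp s) = g s.
Proof.
rewrite /extend; case: pickP => [t /andP[/eqP e1 /eqP e2]|/(_ s)]; last by rewrite !eqxx.
by congr (g _); apply: seg_eq.
Qed.

Definition restrict w f : {ffun seg w -> X} := [ffun s => f (sk s) (sp s)].

Lemma extend_restrict w f : eqdom w (extend (restrict w f)) f.
Proof. by move=> k p /seg_of[s <- <-]; rewrite extendE ffunE. Qed.

Definition ncol w o L R : nat := #|[set g : {ffun seg w -> X} | `[< colored w o L R (extend g) >]]|.

(** Colorings are handled as total functions with arbitrary values off the diagram, so the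
    comparison is a relation [Phi] insensitive to those values. Choosing images of finite functions
    makes it a map, injective by the last hypothesis. *)
Lemma ncol_le w o L R w' o' L' R' (Phi : (nat -> nat -> X) -> (nat -> nat -> X) -> Prop) :
  okfrom 0 w' ->
  (forall f, colored w o L R f -> exists2 f', colored w' o' L' R' f' & Phi f f') ->
  (forall f f' g', eqdom w' f' g' -> Phi f f' -> Phi f g') ->
  (forall f g f', colored w o L R f -> colored w o L R g ->
     Phi f f' -> Phi g f' -> eqdom w f g) ->
  ncol w o L R <= ncol w' o' L' R'.
Proof.
move=> okw' ex ext uniq.
pose P (g : {ffun seg w -> X}) (g' : {ffun seg w' -> X}) := colored w o L R (extend g) ->
  colored w' o' L' R' (extend g') /\ Phi (extend g) (extend g').
have [F FP] : {F & forall g, P g (F g)}.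
  apply: choice => g; have [h|h] := pselect (colored w o L R (extend g)).
    have [f' hf' hP] := ex _ h; exists (restrict w' f') => _.
    have e := eqdom_sym (@extend_restrict w' f').
    by split; [apply: colored_congr hf'|apply: ext hP].
  by exists [ffun _ => x0].
rewrite /ncol -(card_in_imset (f := F)) => [|g1 g2].
  apply: subset_leq_card; apply/subsetP => g' /imsetP[g].
  by rewrite inE => /asboolP/FP[h _] ->; rewrite inE; apply/asboolP.
rewrite !inE => /asboolP h1 /asboolP h2 e; apply/ffunP => s.
rewrite -!extendE; apply: uniq (indom_seg s) => //; first exact: (FP _ h1).2.
by rewrite e; exact: (FP _ h2).2.
Qed.

Lemma ncol_congr w o L L' R R' : okfrom 0 w -> eqdom w L L' -> eqdom w R R' ->
  ncol w o L R = ncol w o L' R'.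
Proof.
move=> okw eL eR; rewrite /ncol; congr #|pred_of_set _|; apply/setP => g; rewrite !inE.
by apply/asboolP/asboolP; apply: colored_congr => //; apply: eqdom_sym.
Qed.

Lemma ncol_gauge_le w o L R h : okfrom 0 w ->
  ncol w o L R <= ncol w o (fun k p => L k p + h k p)%R (fun k p => R k p + h k p)%R.
Proof.
move=> okw; apply: (ncol_le (Phi := fun f f' => eqdom w f'
  (fun k p => act Q (sg (o k p) (- h k p)%R) (f k p)))) => //.
- by move=> f /(colored_gauge h) hf; eexists; first exact: hf.
- by move=> f f' g' e1 e2 k p hd; rewrite -e1 // e2.
- move=> f g f' _ _ e1 e2 k p hd; have := e1 k p hd; rewrite e2 // => e.
  have := congr1 (act Q (sg (o k p) (h k p))) e.
  by rewrite -!actD -sgD subrr /sg oppr0 if_same !act0.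
Qed.

Lemma ncol_gauge w o L R h : okfrom 0 w ->
  ncol w o (fun k p => L k p + h k p)%R (fun k p => R k p + h k p)%R = ncol w o L R.
Proof.
move=> okw; apply/eqP; rewrite eqn_leq ncol_gauge_le // andbT.
apply: leq_trans (ncol_gauge_le o _ _ (fun k p => - h k p)%R okw) _.
by rewrite (@ncol_congr w o _ L _ R) // => k p _; rewrite addrK.
Qed.

Definition flow w (hl hr : nat -> nat -> A) := forall k, k < size w ->
  layer (C := zmod_sq A) (nth pdefault w k) (wfrom 0 w k) (hr k) (hl k.+1).

Lemma flow_opp w hl hr : flow w hl hr ->
  flow w (fun k p => - hl k p)%R (fun k p => - hr k p)%R.
Proof.
move=> h k hk; have [lo hi co] := h k hk; split.
- by move=> p hp; rewrite lo.
- by move=> p p' h1 h2 h3; rewrite (hi _ _ h1 h2 h3).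
- move: co; case: nth => [i|i|i []] /=; first [by move=> [-> ->]|by move=> ->].
Qed.

(** The set of colorings itself is unchanged; the converse inclusion is the same argument for the
    opposite flow. *)
Lemma ncol_flow w o L R hl hr : okfrom 0 w -> flow w hl hr ->
  ncol w o (fun k p => hl k p + L k p)%R (fun k p => hr k p + R k p)%R = ncol w o L R.
Proof.
move=> okw fl; rewrite /ncol; congr #|pred_of_set _|; apply/setP => g; rewrite !inE.
apply/asboolP/asboolP => hg; last exact: colored_flow hg fl.
apply: colored_congr (colored_flow hg (flow_opp fl)) => //; move=> k p _; exact: addKr.
Qed.

(** * Total twist and sliding along strands *)

Definition total w c : A := (\sum_(0 <= k < (size w).+1) \sum_(0 <= p < wfrom 0 w k) c k p)%R.

Lemma total_congr w c c' : eqdom w c c' -> total w c = total w c'.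
Proof.
move=> e; apply: eq_big_nat => k hk; apply: eq_big_nat => p hp.
by apply: e; rewrite /indom; lia.
Qed.

Lemma totalD w c c' : total w (fun k p => c k p + c' k p)%R = (total w c + total w c')%R.
Proof. by rewrite /total -big_split; apply: eq_bigr => k _; rewrite -big_split. Qed.

Lemma totalN w c : total w (fun k p => - c k p)%R = (- total w c)%R.
Proof. by rewrite /total -sumrN; apply: eq_bigr => k _; rewrite -sumrN. Qed.

Definition delta k0 p0 (a : A) : nat -> nat -> A := fun k p =>
  if (k == k0) && (p == p0) then a else 0%R.

Lemma total_delta w k p a : indom w k p -> total w (delta k p a) = a.
Proof.
move=> /andP[hk hp]; rewrite /total.
rewrite (bigD1_seq k) ?mem_index_iota ?iota_uniq //=; try lia.
rewrite [X in (_ + X)%R]big1 ?addr0 => [|j hj].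
  rewrite (bigD1_seq p) ?mem_index_iota ?iota_uniq //=.
  rewrite /delta !eqxx /= big1 ?addr0 // => j hj; by rewrite (negbTE hj).
by rewrite big1 // => i _; rewrite /delta (negbTE hj).
Qed.

Definition ncol_twist w o c : nat := ncol w o (fun _ _ => 0%R) c.

(** A twist at the right end leads from the color to the face, one at the left end from the face to
    the color; hence the difference once all twists are gauged to right ends. *)
Lemma ncol_twist_gauge w o L R : okfrom 0 w -> ncol w o L R = ncol_twist w o (fun k p => R k p - L k p)%R.
Proof.
move=> okw; rewrite /ncol_twist -[RHS](ncol_gauge o _ _ L okw); apply: ncol_congr => // k p _.
- by rewrite add0r.
- by rewrite subrK.
Qed.

(* Twists slide along the strand: [ncol] only depends on their sum on each component. *)
Definition equi w o c c' : Prop := ncol_twist w o c = ncol_twist w o c' /\ total w c = total w c'.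

Definition slide_twist k p k' p' a c : nat -> nat -> A :=
  fun i j => (c i j - delta k p a i j + delta k' p' a i j)%R.

Lemma lstep_dom w k p k' p' : okfrom 0 w -> lstep 0 w k p k' p' ->
  indom w k p /\ indom w k' p'.
Proof.
move=> okw; case=> {k p k' p'} [k p p'|k i|k i] hk; rewrite /indom ?wfromS //.
- move=> hp e; rewrite (ltnW hk) hk hp; split=> //; move: (okw k hk) hp e.
  case: nth => [i|i|i b] /= ok1 hp.
  + by case=> <-; case: ifP; lia.
  + by case: ifP => [h [<-]|h]; [lia|case: ifP => // h' [<-]; lia].
  + by case=> <-; repeat case: ifP; lia.
- by move=> e; have := okw k hk; rewrite e hk /=; lia.
- by move=> e; have := okw k hk; rewrite e (ltnW hk) /=; lia.
Qed.

Lemma flow1 w k (x y : nat -> zmod_sq A) : layer (nth pdefault w k) (wfrom 0 w k) x y ->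
  flow w (fun j p => if j == k.+1 then y p else 0%R) (fun j p => if j == k then x p else 0%R).
Proof.
move=> h j hj /=; rewrite eqSS; case: eqP => [->|_] //; split=> //.
by case: nth => [i|i|i []] /=; rewrite ?oppr0.
Qed.

(** A flow through one piece puts [x] on right ends before it and [y] on left ends after it; gauging
    the latter to right ends turns [y] into [- y]. *)
Lemma ncol_twist_layer w o c k (x y : nat -> zmod_sq A) : okfrom 0 w ->
  layer (nth pdefault w k) (wfrom 0 w k) x y ->
  ncol_twist w o c = ncol_twist w o (fun j p => (if j == k then x p else 0) + c j p
                                - (if j == k.+1 then y p else 0))%R.
Proof.
move=> okw /flow1 h; rewrite {1}/ncol_twist -(ncol_flow o (fun _ _ => 0%R) c okw h) ncol_twist_gauge //.
by apply: ncol_congr => // j p _; rewrite addr0.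
Qed.

Lemma layer_nxt q n p p' (a : A) : piece_ok q n -> p < n -> nxt q p = Some p' ->
  layer (C := zmod_sq A) q n (fun s => if s == p then a else 0%R)
    (fun s => if s == p' then a else 0%R).
Proof.
have E (b b' : bool) : b = b' -> (if b then a else 0%R) = (if b' then a else 0%R) by move=> ->.
case: q => [i|i|i b] /= okq hp.
- case=> <-; split=> /= [s hs|s s' h1 h2 h3|]; try (by apply: E; case: ifP; lia).
  by case: (ltnP p i) => h; rewrite !ifF ?oppr0 //; lia.
- case: ifP => [h [<-]|h]; [|case: ifP => // h' [<-]]; split=> /= [s hs|s s' h1 h2 h3|];
    try (by apply: E; lia).
  + by rewrite !ifF ?oppr0 //; lia.
  + by rewrite !ifF ?oppr0 //; lia.
- case=> e; split=> /= [s hs|s s' h1 h2 h3|].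
  + by apply: E; move: e; repeat case: ifP; lia.
  + by apply: E; move: e; repeat case: ifP; lia.
  + by case: b; split; apply: E; move: e; repeat case: ifP; lia.
Qed.

Lemma layer_cup i n (a : A) : layer (C := zmod_sq A) (Cup i) n (fun _ => 0%R)
  (fun s => if s == i then - a else if s == i.+1 then a else 0)%R.
Proof.
split=> /= [s hs|s s' h1 h2 h3|]; first by rewrite !ifF //; lia.
- by rewrite !ifF //; lia.
- by rewrite !eqxx ifF ?opprK //; lia.
Qed.

Lemma layer_cap i n (a : A) : layer (C := zmod_sq A) (Cap i) n
  (fun s => if s == i then - a else if s == i.+1 then a else 0)%R (fun _ => 0%R).
Proof.
split=> /= [s hs|s s' h1 h2 h3|]; first by rewrite !ifF //; lia.
- by rewrite !ifF //; lia.
- by rewrite !eqxx ifF ?opprK //; lia.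
Qed.

Lemma lstep_equi w o c k p k' p' a : okfrom 0 w -> lstep 0 w k p k' p' ->
  equi w o c (slide_twist k p k' p' a c).
Proof.
move=> okw st; have [d1 d2] := lstep_dom okw st; split; last first.
  rewrite /slide_twist (totalD w (fun i j => c i j - delta k p a i j)%R).
  by rewrite totalD totalN !total_delta // subrK.
have ne i : (i == i.+1) = false by lia.
case: st d1 d2 => {k p k' p'} [k p p' hk hp e|k i hk e|k i hk e] _ _.
(* The flow of [- a] removes [a] before the piece, and the sign change in [ncol_twist_layer]
   restores it after the piece. *)
- rewrite (ncol_twist_layer o c okw (layer_nxt (- a)%R (okw k hk) hp e)).
  apply: ncol_congr => // j s _; rewrite /slide_twist /delta.
  rewrite [X in (X - _)%R = _]addrC; congr (_ + _ + _)%R.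
    by case: (j == k); case: (s == p); rewrite ?oppr0.
  by case: (j == k.+1); case: (s == p'); rewrite ?oppr0 ?opprK.
- have l := layer_cup i (wfrom 0 w k) (- a)%R; rewrite -e in l.
  rewrite (ncol_twist_layer o c okw l); apply: ncol_congr => // j s _; rewrite /slide_twist /delta if_same add0r opprK.
  case: (j == k.+1) => /=; last by rewrite ?subr0 ?addr0.
  case: (eqVneq s i) => [->|_]; first by rewrite ne addr0.
  by case: (s == i.+1); rewrite ?oppr0 ?opprK ?addr0.
- have l := layer_cap i (wfrom 0 w k) a; rewrite -e in l.
  rewrite (ncol_twist_layer o c okw l); apply: ncol_congr => // j s _; rewrite /slide_twist /delta if_same subr0.
  case: (j == k) => /=; last by rewrite ?subr0 ?addr0 add0r.
  case: (eqVneq s i) => [->|_]; first by rewrite ne addr0 addrC.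
  by case: (s == i.+1); rewrite ?subr0 ?addr0 ?add0r // addrC.
Qed.

Lemma equi_trans w o c c' c'' : equi w o c c' -> equi w o c' c'' -> equi w o c c''.
Proof. by move=> [e1 e2] [e3 e4]; split; [rewrite e1|rewrite e2]. Qed.

Lemma equi_refl w o c c' : okfrom 0 w -> eqdom w c c' -> equi w o c c'.
Proof. by move=> okw e; split; [apply: ncol_congr|apply: total_congr]. Qed.

Inductive conn w : nat -> nat -> nat -> nat -> Prop :=
  | ConnRefl k p : conn w k p k p
  | ConnFwd k p k' p' k'' p'' :
      lstep 0 w k p k' p' -> conn w k' p' k'' p'' -> conn w k p k'' p''
  | ConnBwd k p k' p' k'' p'' :
      lstep 0 w k' p' k p -> conn w k' p' k'' p'' -> conn w k p k'' p''.

Lemma conn_equi w o c k p k' p' a : okfrom 0 w -> conn w k p k' p' ->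
  equi w o c (slide_twist k p k' p' a c).
Proof.
move=> okw st; elim: st c => {k p k' p'} [k p|k p k' p' k'' p'' st _ IH|k p k' p' k'' p'' st _ IH] c.
- by apply: equi_refl => // i j _; rewrite /slide_twist subrK.
- apply: equi_trans (lstep_equi o c a okw st) _; apply: equi_trans (IH _) _.
  by apply: equi_refl => // i j _; rewrite /slide_twist addrK.
- apply: equi_trans (lstep_equi o c (- a)%R okw st) _; apply: equi_trans (IH _) _.
  have deltaN x y i j : delta x y (- a)%R i j = (- delta x y a i j)%R.
    by rewrite /delta; case: ifP; rewrite ?oppr0.
  apply: equi_refl => // i j _; rewrite /slide_twist !deltaN opprK; congr (_ + _)%R.
  by rewrite addrAC addrK.
Qed.

(** Slots are emptied one at a time. A slot emptied earlier stays empty, because the twist goes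
    straight into [T] and the slots along the path are left unchanged. *)
Lemma sweep w o (T : nat -> nat -> bool) : okfrom 0 w ->
  (forall k p, indom w k p -> ~~ T k p -> exists k' p', T k' p' /\ conn w k p k' p') ->
  forall c, exists2 c', equi w o c c' & forall k p, indom w k p -> ~~ T k p -> c' k p = 0%R.
Proof.
move=> okw hT c.
have H (S : seq (nat * nat)) : exists2 c', equi w o c c' & forall k p,
    (k, p) \in S -> indom w k p -> ~~ T k p -> c' k p = 0%R.
  elim: S => [|[k p] S [c1 e1 z1]]; first by exists c => //; apply: equi_refl.
  have [/andP[d nT]|h] := boolP (indom w k p && ~~ T k p); last first.
    exists c1 => // k' p'; rewrite inE => /orP[/eqP[-> ->] d nT|]; last exact: z1.
    by rewrite d nT in h.
  have [k' [p' [Tk' cn]]] := hT k p d nT.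
  exists (slide_twist k p k' p' (c1 k p) c1); first exact: equi_trans (conn_equi o c1 _ okw cn).
  move=> i j hij dij nTij; rewrite /slide_twist /delta.
  have -> : (i == k') && (j == p') = false.
    by apply/negbTE/negP => /andP[/eqP ei /eqP ej]; rewrite ei ej Tk' in nTij.
  rewrite addr0; have [/andP[/eqP -> /eqP ->]|h] := boolP ((i == k) && (j == p)).
    by rewrite subrr.
  rewrite subr0 z1 //; move: hij; rewrite inE => /orP[|//].
  by rewrite xpair_eqE (negbTE h).
have [c' e z] := H [seq (sk s, sp s) | s <- enum (seg w : finType)].
exists c' => // k p d nT; apply: z => //; have [s <- <-] := seg_of d.
by apply: (map_f (fun s => (sk s, sp s))); rewrite mem_enum.
Qed.

End Twisted.

(** * Invariance under moves *)

Section Context.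
Variables (a l b : seq piece).
Let w := a ++ l ++ b.
Let n := wfrom 0 a (size a).

Lemma wfromA k : k <= size a -> wfrom 0 w k = wfrom 0 a k.
Proof. exact: wfrom_catl. Qed.

Lemma wfromM k : k <= size l -> wfrom 0 w (size a + k) = wfrom n l k.
Proof. by move=> hk; rewrite /w wfrom_catr wfrom_catl. Qed.

Lemma wfromB j : wfrom 0 w (size a + size l + j) = wfrom (wfrom n l (size l)) b j.
Proof. by rewrite -addnA /w !wfrom_catr. Qed.

Lemma nthA k : k < size a -> nth pdefault w k = nth pdefault a k.
Proof. by move=> hk; rewrite nth_cat hk. Qed.

Lemma nthM k : k < size l -> nth pdefault w (size a + k) = nth pdefault l k.
Proof.
move=> hk; rewrite nth_cat ifF; last by lia.
by rewrite addKn nth_cat hk.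
Qed.

Lemma nthB j : nth pdefault w (size a + size l + j) = nth pdefault b j.
Proof.
rewrite nth_cat ifF; last by lia.
rewrite -addnA addKn nth_cat ifF; last by lia.
by rewrite addKn.
Qed.

Lemma okM : okfrom 0 w -> okfrom n l.
Proof. by move=> /okfrom_cat[_ /okfrom_cat[]]. Qed.

Lemma lstep_context k p k' p' : lstep n l k p k' p' ->
  lstep 0 w (size a + k) p (size a + k') p'.
Proof.
have hs j : j < size l -> size a + j < size w by rewrite !size_cat; lia.
case=> {k p k' p'} [k p p' hk hp e|k i hk e|k i hk e]; rewrite ?addnS.
- by apply: LNext; [exact: hs|rewrite wfromM // ltnW|rewrite nthM].
- by apply: LCup; [exact: hs|rewrite nthM].
- by apply: LCap; [exact: hs|rewrite nthM].
Qed.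

(** Both border slices count as outside: a twist there can be put on the end of the slot that faces
    away from the region. *)
Definition outside (k p : nat) : bool := (k <= size a) || (size a + size l <= k).

Lemma exits_conn k p : okfrom 0 w -> exits n l k p ->
  exists k' p', outside k' p' /\ conn w (size a + k) p k' p'.
Proof.
move=> okw; elim=> {k p} [p|p|k p k' p' st _ [i [j [h1 h2]]]|k p k' p' st _ [i [j [h1 h2]]]].
- exists (size a + 0), p; split; last exact: ConnRefl.
  by rewrite /outside addn0 leqnn.
- exists (size a + size l), p; split; last exact: ConnRefl.
  by rewrite /outside leqnn orbT.
- by exists i, j; split=> //; apply: ConnFwd h2; apply: lstep_context.
- by exists i, j; split=> //; apply: ConnBwd h2; apply: lstep_context.
Qed.

End Context.

Definition agree T w na nl nr (f f' : nat -> nat -> T) : Prop :=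
  (forall k p, k <= na -> indom w k p -> f' k p = f k p) /\
  (forall j p, indom w (na + nl + j) p -> f' (na + nr + j) p = f (na + nl + j) p).

Section Move.
Variables (A : zmodType) (X : finType) (Q : twquandle A X) (x0 : X).
Local Notation D := (double_sq Q).

Lemma chain_fst l n (G : nat -> nat -> D) : chain l n G ->
  chain (C := bool_sq) l n (fun k p => (G k p).1).
Proof.
move=> h k hk; have [lo hi co] := h k hk; split.
- by move=> p hp; rewrite lo.
- by move=> p p' h1 h2 h3; rewrite (hi _ _ h1 h2 h3).
- move: co; case: nth => [i|i|i []]; rewrite /core.
  + by move=> ->.
  + by move=> ->.
  + by case=> -> ->.
  + by case=> -> ->.
Qed.

Lemma face0 o T f k p : T k p = 0%R -> face Q o T f k p = (o k p, f k p).
Proof. by rewrite /face => ->; rewrite dact0. Qed.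

(** The left border meets the region in its right ends only, the right border in its left ends only.
    Twists vanish on all ends inside the region and correspond on the others; this explains the
    different index ranges for [L] and [R]. *)
Record matched (w w' a l r : seq piece) (L R L' R' : nat -> nat -> A) : Prop := Matched {
  mL : forall k p, k <= size a -> L' k p = L k p;
  mR : forall k p, k < size a -> R' k p = R k p;
  mLB : forall j p, L' (size a + size r + j.+1) p = L (size a + size l + j.+1) p;
  mRB : forall j p, R' (size a + size r + j) p = R (size a + size l + j) p;
  cL : forall k p, k < size l -> indom w (size a + k.+1) p -> L (size a + k.+1) p = 0%R;
  cR : forall k p, k < size l -> indom w (size a + k) p -> R (size a + k) p = 0%R;
  cL' : forall k p, k < size r -> indom w' (size a + k.+1) p -> L' (size a + k.+1) p = 0%R;
  cR' : forall k p, k < size r -> indom w' (size a + k) p -> R' (size a + k) p = 0%R }.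

Lemma matched_sym w w' a l r L R L' R' :
  matched w w' a l r L R L' R' -> matched w' w a r l L' R' L R.
Proof. by case=> h1 h2 h3 h4 *; split=> // *; rewrite ?h1 ?h2 ?h3 ?h4. Qed.

Section Half.
Variables (a l r b : seq piece) (o o' : nat -> nat -> bool) (L R L' R' : nat -> nat -> A).
Let w := a ++ l ++ b.
Let w' := a ++ r ++ b.
Let na := size a.
Let nl := size l.
Let nr := size r.
Let n := wfrom 0 a (size a).
Hypotheses (okw : okfrom 0 w) (okw' : okfrom 0 w').
Hypothesis (ow' : chain (C := bool_sq) w' 0 o').
Hypothesis (le : local_equiv n l r).
Hypothesis (ago : agree w na nl nr o o').
Hypothesis (mt : matched w w' a l r L R L' R').

Let szw : size w = na + nl + size b. Proof. by rewrite /w !size_cat addnA. Qed.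
Let szw' : size w' = na + nr + size b. Proof. by rewrite /w' !size_cat addnA. Qed.

Let region_chain f : colored Q w o L R f ->
  chain l n (fun k p => (o (na + k) p, f (na + k) p) : D).
Proof.
move=> hf k hk; have hk' : na + k < size w by rewrite szw /nl; lia.
have := hf _ hk'; rewrite nthM // wfromM ?(ltnW hk) // => ly.
have ew : wfrom 0 w (na + k) = wfrom n l k by rewrite wfromM // ltnW.
have ew' : wfrom 0 w (na + k.+1) = wfrom n l k.+1 by rewrite wfromM.
apply: layer_congr ly; first exact: (okM okw).
- move=> p hp; apply: face0; apply: (cR mt) => //.
  by rewrite /indom (ltnW hk') ew.
- rewrite -wfromS // -addnS => p hp; apply: face0; apply: (cL mt) => //.
  by rewrite /indom addnS hk' -addnS ew'.
Qed.

Let half_ex f : colored Q w o L R f ->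
  exists2 f', colored Q w' o' L' R' f' & agree w na nl nr f f'.
Proof.
move=> hf; have [G [cG G0 G1]] := le_transfer le (region_chain hf).
(* The signs in [G] orient [r] with the same ends as [o'], so uniqueness for [bool_sq] identifies
   them with [o']. Only then do the second coordinates of [G] form a coloring with respect to
   [o']. *)
have bG k : k <= nr -> eqn (wfrom n r k) (fun p => (G k p).1) (fun p => o' (na + k) p).
  move: k; apply: (le_detr le (chain_fst cG)).
  - move=> k hk; have hk' : na + k < size w' by rewrite szw' /nr; lia.
    by have := ow' hk'; rewrite nthM // wfromM ?(ltnW hk) // addnS.
  - move=> p hp; rewrite G0 //= addn0; symmetry; apply: ago.1 => //.
    by rewrite /indom wfromA // hp szw; lia.
  - move=> p hp; rewrite G1 ?(le_width le) //= -[na + size r]addn0 ago.2 ?addn0 //.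
    by rewrite /indom wfromM // (le_width le) hp szw leq_addr.
pose f' k p := if k < na then f k p else if k <= na + nr then (G (k - na) p).2
               else f (k - nr + nl) p.
have f'A k p : k <= na -> indom w k p -> f' k p = f k p.
  rewrite /f' => hk /andP[_ hp]; case: ltnP => // hk'.
  have e : k = na by lia.
  by rewrite e leq_addr subnn G0 //= ?addn0 // /n -(wfromA l b (leqnn _)) -/w -/na -e.
have f'M k p : k <= nr -> f' (na + k) p = (G k p).2.
  by move=> hk; rewrite /f' ifF ?ifT ?addKn //; lia.
have f'B j p : indom w (na + nl + j) p -> f' (na + nr + j) p = f (na + nl + j) p.
  case: j => [|j] /andP[_ hp].
    rewrite addn0 f'M // G1 //= ?addn0 //.
    by move: hp; rewrite addn0 wfromM.
  by rewrite /f' !ifF; [congr f| |]; lia.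
exists f'; last by split.
have wB j : wfrom 0 w' (na + nr + j) = wfrom 0 w (na + nl + j).
  by rewrite !wfromB (le_width le).
have oke k : k < size w' -> piece_ok (nth pdefault w' k) (wfrom 0 w' k) by exact: okw'.
move=> k hk; have [h|h] := ltnP k na; last have [h'|h'] := ltnP k (na + nr).
- have hkw : k < size w by rewrite szw; lia.
  have ek : wfrom 0 w' k = wfrom 0 w k by rewrite !wfromA // ltnW.
  have en : nth pdefault w' k = nth pdefault w k by rewrite !nthA.
  have := hf k hkw; rewrite -en -ek; apply: layer_congr; first exact: okw'.
  + by move=> p hp; rewrite /face (mR mt) // ago.1 ?f'A ?(ltnW h) // /indom -ek hp ltnW.
  + have ek' : wfrom 0 w' k.+1 = wfrom 0 w k.+1 by rewrite !wfromA.
    by rewrite -wfromS // => p hp; rewrite /face (mL mt) // ago.1 ?f'A // /indom -ek' hp hkw.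
- have [j e] : {j | k = na + j} by exists (k - na); lia.
  have hj : j < nr by rewrite e in h'; lia.
  have okr := oke k hk.
  rewrite e in hk okr *; rewrite nthM ?wfromM ?(ltnW hj) // in okr *.
  have ej : wfrom 0 w' (na + j) = wfrom n r j by rewrite wfromM // ltnW.
  have ej' : wfrom 0 w' (na + j.+1) = wfrom n r j.+1 by rewrite wfromM.
  apply: layer_congr (cG j hj) => //.
  + move=> p hp; rewrite face0; last by apply: (cR' mt) => //; rewrite /indom ej hp ltnW.
    by rewrite f'M ?(ltnW hj) // -bG ?(ltnW hj) //; case: (G j p).
  + rewrite -wfromS // => p hp; rewrite -addnS face0; last first.
      by apply: (cL' mt) => //; rewrite /indom ej' hp addnS hk.
    by rewrite f'M // -bG //; case: (G j.+1 p).
- have [j e] : {j | k = na + nr + j} by exists (k - na - nr); lia.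
  have okr := oke k hk.
  rewrite e in hk okr *; rewrite szw' ltn_add2l in hk.
  have hkw : na + nl + j < size w by rewrite szw ltn_add2l.
  rewrite wB nthB in okr *; have := hf _ hkw; rewrite nthB; apply: layer_congr => //.
  + move=> p hp; have hd : indom w (na + nl + j) p by rewrite /indom hp ltnW.
    by rewrite /face (mRB mt) ago.2 // f'B.
  + have := wfromS 0 hkw; rewrite nthB => <-; rewrite -!addnS => p hp.
    have hd : indom w (na + nl + j.+1) p by rewrite /indom hp addnS hkw.
    by rewrite /face (mLB mt) ago.2 // f'B.
Qed.

(** Recoloring only the region gives an injection: two colorings with a common image agree outside
    the region, and then inside it by [determined]. *)
Lemma half_le : ncol Q x0 w o L R <= ncol Q x0 w' o' L' R'.
Proof.
apply: (@ncol_le A X Q x0 w o L R w' o' L' R' (agree w na nl nr)) => //.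
- move=> f f' g' e [h1 h2]; split=> [k p hk hp|j p hp].
  + rewrite -h1 // e // /indom szw'; case/andP: hp => _.
    by rewrite !wfromA // => ->; rewrite andbT; lia.
  + rewrite -h2 // e //; move: hp; rewrite /indom szw szw' !wfromB (le_width le).
    by case/andP=> hj ->; rewrite andbT; lia.
- move=> f g f' hf hg [h1 h2] [h3 h4] k p hd; have /andP[hk hp] := hd.
  have [h|h] := leqP k na; first by rewrite -h1 // h3.
  have [h'|h'] := leqP (na + nl) k.
    have [j e] : {j | k = na + nl + j} by exists (k - na - nl); lia.
    by rewrite e in hd *; rewrite -h2 // h4.
  have [j e] : {j | k = na + j} by exists (k - na); lia.
  have hj : j <= nl by lia.
  rewrite e wfromM // in hp *.
  have E := le_detl le (region_chain hf) (region_chain hg).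
  suff /(congr1 snd) : (o (na + j) p, f (na + j) p) = (o (na + j) p, g (na + j) p) by [].
  apply: (E _ _ j hj p hp) => s hs.
  + by rewrite addn0 -h1 ?h3 // /indom wfromA // hs andbT szw; lia.
  + by rewrite -[na + size l]addn0 -h2 ?h4 // /indom addn0 szw wfromM // hs andbT; lia.
Qed.
End Half.

Lemma sum_surgery (u u' : nat -> A) m i i' M :
  (forall k, k < m -> u' k = u k) ->
  (forall k, k < i -> u (m + k) = 0%R) -> (forall k, k < i' -> u' (m + k) = 0%R) ->
  (forall j, j < M -> u' (m + i' + j) = u (m + i + j)) ->
  (\sum_(0 <= k < m + i + M) u k = \sum_(0 <= k < m + i' + M) u' k)%R.
Proof.
move=> h1 h2 h3 h4.
have split3 (v : nat -> A) j : (forall k, k < j -> v (m + k) = 0%R) ->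
  (\sum_(0 <= k < m + j + M) v k =
   \sum_(0 <= k < m) v k + \sum_(0 <= k < M) v (m + j + k)%N)%R.
  move=> hv; rewrite !big_mkord !big_split_ord /=; congr (_ + _)%R.
  by rewrite [X in (_ + X)%R]big1 ?addr0 // => k _; apply: hv.
rewrite !split3 //; congr (_ + _)%R; apply: eq_big_nat => k /andP[_ hk].
- by rewrite h1.
- by rewrite h4.
Qed.

Section Step.
Variables (a l r b : seq piece) (o o' : nat -> nat -> bool).
Let w := a ++ l ++ b.
Let w' := a ++ r ++ b.
Let n := wfrom 0 a (size a).
Hypotheses (okw : okfrom 0 w) (okw' : okfrom 0 w').
Hypotheses (ow : chain (C := bool_sq) w 0 o) (ow' : chain (C := bool_sq) w' 0 o').
Hypothesis (le : local_equiv n l r).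
Hypothesis (ago : agree w (size a) (size l) (size r) o o').

Let szw : size w = size a + size l + size b. Proof. by rewrite /w !size_cat addnA. Qed.
Let szw' : size w' = size a + size r + size b. Proof. by rewrite /w' !size_cat addnA. Qed.

Lemma width_step j : wfrom 0 w' (size a + size r + j) = wfrom 0 w (size a + size l + j).
Proof. by rewrite !wfromB (le_width le). Qed.

Lemma agree_sym : agree w' (size a) (size r) (size l) o' o.
Proof.
case: ago => h1 h2; split=> [k p hk|j p].
- rewrite /indom wfromA // => /andP[_ hp]; symmetry; apply: h1 => //.
  by rewrite /indom szw wfromA // hp andbT; lia.
- rewrite /indom width_step szw' => /andP[hj hp]; symmetry; apply: h2.
  by rewrite /indom szw hp andbT; lia.
Qed.

Lemma total_matched L R L' R' : matched w w' a l r L R L' R' ->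
  (total w (fun k p => R k p - L k p) = total w' (fun k p => R' k p - L' k p))%R.
Proof.
move=> mt; have hwA k : k <= size a -> wfrom 0 w' k = wfrom 0 w k.
  by move=> hk; rewrite !wfromA.
rewrite (totalD w R) (totalD w' R') !totalN; congr (_ - _)%R; rewrite /total.
- rewrite szw szw' -!addnS; apply: sum_surgery => [k hk|k hk|k hk|j hj].
  + by rewrite hwA ?(ltnW hk) //; apply: eq_big_nat => p _; rewrite (mR mt).
  + rewrite big_nat big1 // => p hp; apply: (cR mt) => //.
    by move: hp; rewrite /indom szw; lia.
  + rewrite big_nat big1 // => p hp; apply: (cR' mt) => //.
    by move: hp; rewrite /indom szw'; lia.
  + by rewrite width_step; apply: eq_big_nat => p _; rewrite (mRB mt).
(* The left ends inside the region lie one slice later than the right ends, from [size a + 1] to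
   [size a + size l]; hence the cut after [size a + 1] slices. *)
- rewrite szw szw' -!addSn; apply: sum_surgery => [k hk|k hk|k hk|j hj].
  + by rewrite hwA //; apply: eq_big_nat => p _; rewrite (mL mt).
  + rewrite big_nat big1 // => p hp; rewrite addSnnS; apply: (cL mt) => //.
    by move: hp; rewrite /indom szw addSnnS; lia.
  + rewrite big_nat big1 // => p hp; rewrite addSnnS; apply: (cL' mt) => //.
    by move: hp; rewrite /indom szw' addSnnS; lia.
  + by rewrite !addSn -!addnS width_step; apply: eq_big_nat => p _; rewrite (mLB mt).
Qed.

Lemma ncol_matched L R L' R' : matched w w' a l r L R L' R' ->
  ncol Q x0 w o L R = ncol Q x0 w' o' L' R'.
Proof.
move=> mt; apply/eqP; rewrite eqn_leq (half_le okw okw' ow' le ago mt) /=.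
exact: (half_le okw' okw ow (local_equiv_sym le) agree_sym (matched_sym mt)).
Qed.

Lemma step_twist (c : nat -> nat -> A) :
  exists c', ncol_twist Q x0 w o c = ncol_twist Q x0 w' o' c' /\ total w c = total w' c'.
Proof.
have [k p /andP[hk hp]|c1 [e1 e1'] z1] := @sweep A X Q x0 w o (outside a l) okw _ c.
  rewrite negb_or -ltnNge -ltnNge => /andP[h1 h2].
  have [j e] : {j | k = size a + j} by exists (k - size a); lia.
  rewrite e in hp h2 *; have hj : j <= size l by lia.
  by apply: exits_conn => //; apply: (le_exitl le) => //; rewrite /n -(wfromM a b hj); exact: hp.
(* The swept twists go to left ends up to the left border, with a minus sign since left ends count
   negatively, and to right ends beyond it. If [r] is empty and [l] is not, the fused border slice
   of [w'] receives twists at both ends. *)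
pose L k p := if k <= size a then (- c1 k p)%R else 0%R.
pose R k p := if k <= size a then 0%R else c1 k p.
pose L' k p := if k <= size a then L k p else 0%R.
pose R' k p := if k < size a + size r then 0%R else R (k - size r + size l) p.
have mt : matched w w' a l r L R L' R'.
  split.
  - by move=> k p hk; rewrite /L' hk.
  - by move=> k p hk; rewrite /R' /R !ifT //; lia.
  - by move=> j p; rewrite /L' /L !ifF //; lia.
  - by move=> j p; rewrite /R' ifF; [congr R|]; lia.
  - by move=> k p hk _; rewrite /L ifF //; lia.
  - move=> k p hk hd; rewrite /R; case: ifPn => // h; apply: z1 => //.
    by rewrite negb_or; lia.
  - by move=> k p hk _; rewrite /L' ifF //; lia.
  - by move=> k p hk _; rewrite /R' ifT //; lia.
exists (fun k p => R' k p - L' k p)%R.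
have ec : eqdom w c1 (fun k p => R k p - L k p)%R.
  by move=> k p _; rewrite /R /L; case: ifP => _; rewrite ?subr0 ?sub0r ?opprK.
rewrite -ncol_twist_gauge // -(ncol_matched mt) -(total_matched mt) e1 e1' (total_congr ec); split=> //.
by rewrite ncol_twist_gauge //; apply: ncol_congr.
Qed.

End Step.
End Move.

(** * From single moves to topological equivalence *)

Lemma valid_okfrom w : valid w -> okfrom 0 w.
Proof. by case/andP => /allP h _ k hk; apply: (h k); rewrite mem_iota. Qed.

Lemma valid_width w : valid w -> wfrom 0 w (size w) = 0.
Proof. by case/andP => _ /eqP. Qed.

Lemma oriented_chain w o : valid w -> oriented w o -> chain (C := bool_sq) w 0 o.
Proof.
move=> /valid_okfrom okw ow k hk; have [h1 h2] := ow k hk; have := okw k hk.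
change (width_at w k) with (wfrom 0 w k) in h1; move: h1 h2.
set n := wfrom 0 w k; set q := nth _ _ _ => h1 h2 okq; split.
- by move=> p hp; apply: h1; [move: okq hp; case: (q) => /=; lia|exact: nxt_lo].
- by move=> p p' h h' e; apply: h1 => //; apply: nxt_hi.
- case: q okq h1 h2 => [i|i|i b] /= okq h1 h2.
  + by case: (o k.+1 i) h2; case: (o k.+1 i.+1).
  + by case: (o k i) h2; case: (o k i.+1).
  + have e0 := h1 i i.+1 (ltnW okq); have e1 := h1 i.+1 i okq.
    rewrite e0 ?eqxx // e1; first by case: b {h1 h2 e0 e1}.
    by rewrite eqxx ifF //; lia.
Qed.

(** Slice 0 is empty, so the first piece can only be a cup, and it opens slot 0 of slice 1. *)
Lemma knot_slot w : is_knot w -> inhabited (seg w).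
Proof.
case/and3P => vw sz _; have okw := valid_okfrom vw.
have d : indom w 1 0.
  rewrite /indom sz wfromS // wfrom0; have := okw 0 sz.
  by rewrite wfrom0; case: nth => //= i b; rewrite ltn0.
by have [s _ _] := seg_of d; exists.
Qed.

Section Invariance.
Variables (A : zmodType) (X : finType) (Q : twquandle A X) (x0 : X).

Lemma ncol_orient w o o' L R : okfrom 0 w -> eqdom w o o' ->
  ncol Q x0 w o L R = ncol Q x0 w o' L R.
Proof.
have H (o1 o2 : nat -> nat -> bool) f : okfrom 0 w -> eqdom w o1 o2 ->
    colored Q w o1 L R f -> colored Q w o2 L R f.
  move=> okw e h k hk; apply: layer_congr (h k hk); first exact: okw.
  - by move=> p hp; rewrite /face e // /indom hp (ltnW hk).
  - by move=> p; rewrite -wfromS // => hp; rewrite /face e // /indom hp hk.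
move=> okw e; rewrite /ncol; congr #|pred_of_set _|; apply/setP => g; rewrite !inE.
by apply/asboolP/asboolP; apply: H => //; apply: eqdom_sym.
Qed.

Definition transports (D D' : odiag) : Prop := forall c, exists c',
  ncol_twist Q x0 D.1 D.2 c = ncol_twist Q x0 D'.1 D'.2 c' /\ total D.1 c = total D'.1 c'.

(** Both directions are kept because [top_equiv] is closed under symmetry. *)
Lemma step_transports D D' : top_step D D' -> transports D D' /\ transports D' D.
Proof.
case: D D' => [w o] [w' o'] [/= vw vw' orw orw' []].
  move=> [<- e]; have e' : eqdom w o o' by move=> k p /andP[]; exact: e.
  have okw := valid_okfrom vw.
  split=> c; exists c; split=> //=; apply: ncol_orient => //; exact: eqdom_sym.
move=> [a [l [r [b [ew ew' hm h1 h2]]]]]; subst w w'.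
have okw := valid_okfrom vw; have okw' := valid_okfrom vw'.
have ow := oriented_chain vw orw; have ow' := oriented_chain vw' orw'.
have le : local_equiv (wfrom 0 a (size a)) l r.
  have okl := okM okw; have okr := okM okw'.
  by case: hm => hm; [|apply: local_equiv_sym]; apply: move_local_equiv.
have ago : agree (a ++ l ++ b) (size a) (size l) (size r) o o'.
  by split=> [k p hk /andP[_ hp]|j p /andP[_ hp]]; [apply: h1|apply: h2].
split=> c; first exact: (@step_twist _ _ Q x0 _ _ _ _ _ _ okw okw' ow ow' le ago).
exact: (@step_twist _ _ Q x0 _ _ _ _ _ _ okw' okw ow' ow (local_equiv_sym le)
  (agree_sym le ago)).
Qed.

Lemma equiv_transports D D' : top_equiv D D' -> transports D D' /\ transports D' D.
Proof.
elim=> {D D'} [D D'|D|D D' _ [h1 h2]|D D' D'' _ [h1 h2] _ [h3 h4]].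
- exact: step_transports.
- by split=> c; exists c.
- by [].
- split=> c.
  + have [c' [e1 e2]] := h1 c; have [c'' [e3 e4]] := h3 c'.
    by exists c''; rewrite e1 e2.
  + have [c' [e1 e2]] := h4 c; have [c'' [e3 e4]] := h2 c'.
    by exists c''; rewrite e1 e2.
Qed.

Lemma link_lstep w (k : 'I_(size w)) (s t : seg w) : link k s t ->
  lstep 0 w (sk s) (sp s) (sk t) (sp t).
Proof.
rewrite /link => /or3P[/and3P[/eqP e1 /eqP e2 /eqP e3]||].
- have /andP[_ hs] := indom_seg s; rewrite e1 in hs *; rewrite e2.
  exact: LNext.
- case e: (nth _ _ _) => [i||] // /and4P[/eqP -> /eqP -> /eqP -> /eqP ->].
  exact: LCup.
- case e: (nth _ _ _) => [|i|] // /and4P[/eqP -> /eqP -> /eqP -> /eqP ->].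
  exact: LCap.
Qed.

Lemma connect_conn w (s t : seg w) : connect (@adj w) s t ->
  conn w (sk s) (sp s) (sk t) (sp t).
Proof.
case/connectP => pth; elim: pth s => [|s' pth IH] s /=.
  by move=> _ ->; exact: ConnRefl.
case/andP => /existsP[k /orP[h|h]] hp e; have := IH _ hp e.
- by apply: ConnFwd; apply: link_lstep h.
- by apply: ConnBwd; apply: link_lstep h.
Qed.

(** Connectedness lets all twists be swept into one slot [s0], where they add up to the total. *)
Lemma knot_ncol w o c c' : is_knot w -> total w c = total w c' ->
  ncol_twist Q x0 w o c = ncol_twist Q x0 w o c'.
Proof.
move=> kw; have [s0] := knot_slot kw; case/and3P: kw => vw _ /forallP cn.
have okw := valid_okfrom vw.
pose T k p := (k == sk s0) && (p == sp s0).
have hT k p : indom w k p -> ~~ T k p -> exists k' p', T k' p' /\ conn w k p k' p'.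
  move=> d _; have [s <- <-] := seg_of d; exists (sk s0), (sp s0).
  by rewrite /T !eqxx; split=> //; apply: connect_conn; exact: (forallP (cn s) s0).
have one (c1 : nat -> nat -> A) : (forall k p, indom w k p -> ~~ T k p -> c1 k p = 0%R) ->
    eqdom w c1 (delta (sk s0) (sp s0) (total w c1)).
  move=> z; have e : eqdom w c1 (delta (sk s0) (sp s0) (c1 (sk s0) (sp s0))).
    move=> k p d; rewrite /delta; case: ifPn => [/andP[/eqP -> /eqP ->] //|h].
    exact: z.
  by rewrite (total_congr e) total_delta ?indom_seg.
have [c1 [e1 t1] z1] := @sweep A X Q x0 w o T okw hT c.
have [c2 [e2 t2] z2] := @sweep A X Q x0 w o T okw hT c'.
move=> tt; rewrite e1 e2; apply: ncol_congr => // k p d.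
by rewrite (one c1 z1) // (one c2 z2) // -t1 -t2 tt.
Qed.

End Invariance.

(** * Colorings of fronts *)

Section Front.
Variables (A : zmodType) (X : finType) (Q : twquandle A X) (x0 : X).
Variables (ua da : A) (op : X -> X -> X) (u d : X -> X).
Hypothesis uE : forall x, u x = act Q ua x.
Hypothesis dE : forall x, d x = act Q da x.
Hypothesis opE : forall x y, act Q (ua + da)%R (op x y) = qop Q true x y.

Lemma act_inj a : injective (act Q a).
Proof. by move=> x y e; rewrite -(act0 Q x) -(act0 Q y) -(addNr a) !actD e. Qed.

Variables (w : seq piece) (o : nat -> nat -> bool).
Hypotheses (vw : valid w) (fw : is_front w) (orw : oriented w o).
Let ow : chain (C := bool_sq) w 0 o := oriented_chain vw orw.
Let okw : okfrom 0 w := valid_okfrom vw.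

(** At a right cusp the twist sits on the incoming branch. At a crossing it sits on the under
    semi-arc to the left of the over-strand, whose color is an [op]-product that [ua + da] turns
    into the quandle product. That arc is after the crossing (hence in [frontL]) if the over-strand
    runs to the right, and before it otherwise. The [sg] cancels the sign with which twists act on
    leftward strands. *)
Definition frontR k p : A :=
  match nth pdefault w k with
  | Cap i => if p == (if o k i then i else i.+1) then if o k i then ua else da else 0
  | Cr i _ => if p == i then if o k i.+1 then 0 else sg (o k i) (ua + da) else 0
  | Cup _ => 0
  end%R.

(** At a left cusp the twist sits on the outgoing branch; its minus sign makes up for left ends
    counting negatively in the total. *)
Definition frontL k p : A :=
  if k is j.+1 then
    match nth pdefault w j with
    | Cup i => if p == (if o k i then i else i.+1) then - (if o k i then da else ua) else 0
    | Cr i _ => if p == i.+1 then if o j i.+1 then sg (o j i) (ua + da) else 0 else 0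
    | Cap _ => 0
    end%R
  else 0%R.

Lemma sum_single n i (v : A) : i < n ->
  (\sum_(0 <= p < n) (if p == i then v else 0) = v)%R.
Proof.
move=> hi; rewrite (bigD1_seq i) ?mem_index_iota ?iota_uniq //= eqxx.
by rewrite big1 ?addr0 // => j /negbTE ->.
Qed.

(** In all four orientations a crossing contributes [- (ua + da)] times its sign; an upward cusp
    contributes [ua] and a downward one [da]. *)
Lemma total_front : total w (fun k p => frontR k p - frontL k p)%R =
  (ua *~ ((n_up w o)%:Z - writhe w o) + da *~ ((n_down w o)%:Z - writhe w o))%R.
Proof.
(* The last slice is empty and slice 0 has no left twists, so after a shift by one both sums run
   over the pieces. *)
rewrite totalD totalN /total big_nat_recr //= valid_width // [X in (_ + X - _)%R]big_geq // addr0.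
rewrite [X in (_ - X)%R]big_nat_recl // [X in (_ - (X + _))%R]big1 // add0r.
have cnt P : ((count P (iota 0 (size w)))%:Z = \sum_(0 <= k < size w) (P k)%:Z)%R.
  rewrite -sum1_count /index_iota subn0 big_mkcond /= (big_morph Posz PoszD (erefl _)).
  by apply: eq_bigr => k _; case: (P k).
rewrite /n_up /n_down /writhe !cnt -(big_mkord xpredT (fun k => csign w o k)).
rewrite -!sumrB !mulrz_sumr -big_split; apply: eq_big_nat => k /= hk.
rewrite wfromS // /frontR /frontL /up_cusp /down_cusp /csign.
have okk := okw hk; have [lo _ co] := ow hk; move: okk lo co.
case e: (nth _ _ _) => [i|i|i b] /= okk lo co.
- rewrite [X in (X - _)%R]big1 // sum_single; last by case: ifP; lia.
  by case: (o k.+1 i); rewrite !subr0 ?mulr0z ?mulr1z ?addr0 ?add0r opprK.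
- rewrite [X in (_ - X)%R]big1 // sum_single; last by case: ifP; lia.
  by case: (o k i); rewrite !subr0 ?mulr0z ?mulr1z ?addr0 ?add0r.
- rewrite !sum_single //; try lia.
  case: (o k i); case: (o k i.+1) => /=;
  rewrite ?sub0r ?subr0 ?opprK ?mulr1z ?mulrN1z ?opprD //.
Qed.

Definition front_ok k (F : nat -> nat -> X) : Prop :=
  let q := nth pdefault w k in
  (forall p p', p < wfrom 0 w k -> nxt q p = Some p' ->
     ~~ (if q is Cr i _ then p == i else false) -> F k.+1 p' = F k p) /\
  match q with
  | Cr i _ => if o k i.+1 then F k.+1 i.+1 = op (F k i) (F k i.+1)
              else F k i = op (F k.+1 i.+1) (F k i.+1)
  | Cup i => if o k.+1 i then F k.+1 i = d (F k.+1 i.+1) else F k.+1 i.+1 = u (F k.+1 i)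
  | Cap i => if o k i then F k i.+1 = u (F k i) else F k i = d (F k i.+1)
  end.

Lemma col_ok_front (g : {ffun seg w -> X}) (k : 'I_(size w)) :
  (forall s1 s2 t, col_ok op u d o g k s1 s2 t) <-> front_ok k (extend x0 g).
Proof.
have okk : piece_ok (nth pdefault w k) (wfrom 0 w k) := okw (ltn_ord k).
have wS : wfrom 0 w k.+1 = wd (nth pdefault w k) (wfrom 0 w k) by apply: wfromS.
have dA p : p < wfrom 0 w k -> indom w k p by move=> h; rewrite /indom h ltnW.
have dB p : p < wfrom 0 w k.+1 -> indom w k.+1 p by move=> h; rewrite /indom h ltn_ord.
have slot (j p : nat) : indom w j p -> exists s : seg w,
    [/\ sk s = j, sp s = p & extend x0 g j p = g s].
  by move=> h; have [s e1 e2] := seg_of h; exists s; rewrite -e1 -e2 extendE.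
split=> [h|[h1 h2] s1 s2 t].
- split.
  + move=> p p' hp e nu.
    have [s [ks ps ->]] := slot _ _ (dA _ hp).
    have [t [kt pt ->]] := slot _ _ (lstep_dom okw (LNext (ltn_ord k) hp e)).2.
    have := h s s t; rewrite /col_ok => /and4P[+ _ _ _]; rewrite ks kt ps pt e !eqxx nu /=.
    by move/eqP.
  + move: okk wS h; rewrite /col_ok; case e: (nth _ _ _) => [i|i|i b] /= okk wS h.
    * have d0 : i < wfrom 0 w k.+1 by lia.
      have d1 : i.+1 < wfrom 0 w k.+1 by lia.
      have [s [ks ps ->]] := slot _ _ (dB _ d0).
      have [t [kt pt ->]] := slot _ _ (dB _ d1).
      have /and3P[_ + _] := h s t t; rewrite ks kt ps pt !eqxx /=.
      by case: ifP => _ /eqP.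
    * have d0 : i < wfrom 0 w k by lia.
      have [s [ks ps ->]] := slot _ _ (dA _ d0).
      have [t [kt pt ->]] := slot _ _ (dA _ okk).
      have /andP[_ +] := h s t t; rewrite ks kt ps pt !eqxx /=.
      by case: ifP => _ /eqP.
    * have d0 : i < wfrom 0 w k by lia.
      have d1 : i.+1 < wfrom 0 w k.+1 by lia.
      have [s [ks ps ->]] := slot _ _ (dA _ d0).
      have [s' [ks' ps' ->]] := slot _ _ (dA _ okk).
      have [t [kt pt ->]] := slot _ _ (dB _ d1).
      have /and3P[_ + _] := h s s' t; rewrite ks ks' kt ps ps' pt !eqxx /=.
      by case: ifP => _ /eqP.
- rewrite /col_ok -!(extendE x0).
  have c1 : [&& sk s1 == k, sk t == k.+1, nxt (nth pdefault w k) (sp s1) == Some (sp t)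
      & ~~ (if nth pdefault w k is Cr i _ then sp s1 == i else false)] ==>
      (extend x0 g (sk t) (sp t) == extend x0 g (sk s1) (sp s1)).
    apply/implyP => /and4P[/eqP a1 /eqP a2 /eqP a3 nu]; apply/eqP.
    have /andP[_ hp] := indom_seg s1; rewrite a1 in hp.
    by rewrite a1 a2; apply: h1 a3 nu.
  rewrite c1 {c1}; move: h2.
  case: (nth _ _ _) => [i|i|i b] h2 /=.
  + rewrite andbT; apply/implyP => /and4P[/eqP -> /eqP -> /eqP -> /eqP ->].
    by move: h2; case: ifP => _ ->.
  + apply/implyP => /and4P[/eqP -> /eqP -> /eqP -> /eqP ->].
    by move: h2; case: ifP => _ ->.
  + rewrite andbT; apply/implyP => /and5P[/eqP -> /eqP -> /eqP -> /eqP -> /andP[/eqP -> /eqP ->]].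
    by move: h2; case: ifP => _; [move=> ->|move=> <-].
Qed.

(** Twists sit only on cusp legs and under-strands; any other strand passes the piece with its color
    unchanged. *)
Lemma front0 k p p' : k < size w -> p < wfrom 0 w k ->
  nxt (nth pdefault w k) p = Some p' ->
  ~~ (if nth pdefault w k is Cr i _ then p == i else false) ->
  [/\ frontR k p = 0%R, frontL k.+1 p' = 0%R & o k.+1 p' = o k p].
Proof.
move=> hk hp e nu; split; last exact: (orw hk).1 hp e.
- move: e nu; rewrite /frontR; case: nth => [//|i /= |i b /= _ /negbTE -> //].
  by case: ifP => [h _ _|h]; [|case: ifP => // h' _ _]; rewrite ifF //; case: ifP; lia.
- move: e nu; rewrite /frontL; case: nth => [i /= [<-] _|//|i b /= [<-] h].
  + by rewrite ifF //; case: (ltnP p i) => h; case: ifP; lia.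
  + by rewrite ifF //; move: h; repeat case: ifP; lia.
Qed.

Lemma face_nxt F k p p' : k < size w -> p < wfrom 0 w k ->
  nxt (nth pdefault w k) p = Some p' ->
  ~~ (if nth pdefault w k is Cr i _ then p == i else false) ->
  face Q o frontL F k.+1 p' = face Q o frontR F k p <-> F k.+1 p' = F k p.
Proof.
move=> hk hp e nu; have [h1 h2 h3] := front0 hk hp e nu.
by rewrite !face0 // h3; split=> [[]|->].
Qed.

Lemma sg0 s : sg s (0 : A)%R = 0%R.
Proof. by case: s; rewrite /sg ?oppr0. Qed.

Lemma act_opp a x y : act Q (- a)%R x = y <-> x = act Q a y.
Proof.
by split=> [<-|->]; rewrite -actD ?subrr ?addNr act0.
Qed.

Lemma pair_eq2 (s : bool) (x y : X) : (s, x) = (s, y) <-> x = y.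
Proof. by split=> [[]|->]. Qed.

(** In a front the over-strand of every crossing descends, so [b] is true. If it runs to the left
    its sign selects [qop false], and the relation is the front rule solved for the other under
    semi-arc. *)
Lemma front_core F k (q := nth pdefault w k) (i := pidx q)
    (x := face Q o frontR F k) (y := face Q o frontL F k.+1) : k < size w ->
  core q (x i) (x i.+1) (y i) (y i.+1) <->
  match q with
  | Cr i _ => F k.+1 i = F k i.+1 /\ if o k i.+1 then F k.+1 i.+1 = op (F k i) (F k i.+1)
              else F k i = op (F k.+1 i.+1) (F k i.+1)
  | Cup i => if o k.+1 i then F k.+1 i = d (F k.+1 i.+1) else F k.+1 i.+1 = u (F k.+1 i)
  | Cap i => if o k i then F k i.+1 = u (F k i) else F k i = d (F k i.+1)
  end.
Proof.
move=> hk; have ne j : (j == j.+1) = false by lia.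
have ne' j : (j.+1 == j) = false by lia.
have := ow hk => -[_ _]; rewrite /x /y /i /q {x y i q}.
have := elimT (all_nthP pdefault) fw k hk.
case e: (nth _ _ _) => [i|i|i b]; rewrite /core /face /dact /frontL /frontR e /=.
- move=> _ -> /=; rewrite pair_eq2; case: (o k.+1 i); rewrite /= eqxx ?ne ?ne' /= ?oppr0 ?opprK act0.
  + by rewrite dE; split=> [h|h]; [apply/act_opp|symmetry; apply/act_opp].
  + by rewrite uE; apply: act_opp.
- move=> _ -> /=; rewrite pair_eq2; case: (o k i); rewrite /= eqxx ?ne ?ne' /= ?oppr0 ?opprK act0.
  + by rewrite uE.
  + by rewrite dE; split=> ->.
- move=> -> [-> ->] /=; rewrite !eqxx ne ne' /= !sg0 !act0.
  have sgK t a : sg t (sg t a) = a :> A by case: t; rewrite /= ?opprK.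
  rewrite !pair_eq2; case: (o k i.+1); rewrite /= ?sg0 ?sgK ?act0.
  + split=> -[h1 h2]; split=> //; first by apply: (@act_inj (ua + da)%R); rewrite opE.
    by rewrite h2 opE.
  + split=> -[h1 h2]; split=> //.
      by apply: (@act_inj (ua + da)%R); rewrite opE h2 -{1}[true]/(~~ false) qopK.
    by rewrite h2 opE (qopK Q true).
Qed.

Lemma colored_front F : (colored Q w o frontL frontR F) <->
  (forall k, k < size w -> front_ok k F).
Proof.
split=> h k hk; have {h} := h k hk; have okk := okw hk; rewrite /front_ok.
- move=> [lo hi /front_core-/(_ hk) co]; split; last first.
    by move: co; case: nth => // i b [].
  move=> p p' hp e nu; have [h|h] := ltnP p (pidx (nth pdefault w k)).
    by move: (e); rewrite nxt_lo // => -[<-]; apply/(face_nxt F hk hp (nxt_lo h) nu); exact: lo.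
  have [h'|h'] := leqP (pidx (nth pdefault w k) + pin (nth pdefault w k)) p.
    apply/(face_nxt F hk hp e nu); apply: hi => //.
    have hs : p - pin (nth pdefault w k) + pout (nth pdefault w k) + pin (nth pdefault w k)
      = p + pout (nth pdefault w k) by lia.
    by move: e; rewrite (nxt_hi h' hs) => -[<-].
  move: e nu h h' co; case: nth => [i|i|i b] /= e nu h h' co; first lia.
    by move: e; rewrite ifF ?ifT //; lia.
  case: e => <-.
  have -> : p = i.+1 by lia.
  by rewrite eqxx ifF; [case: co|lia].
- move=> [h1 h2]; split.
  + move=> p hp; have hn : p < wfrom 0 w k by move: okk hp; case: nth => /=; lia.
    apply/face_nxt => //; first exact: nxt_lo.
      by move: hp; case: nth => //= i b; lia.
    apply: h1 => //; first exact: nxt_lo.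
    by move: hp; case: nth => //= i b; lia.
  + move=> p p' hp hn e; have nu : ~~ (if nth pdefault w k is Cr i _ then p == i else false).
      by move: hp; case: nth => //= i b; lia.
    by apply/face_nxt => //; [exact: nxt_hi|apply: h1 => //; exact: nxt_hi].
  + apply/front_core => //; move: h1 h2 okk; case: nth => // i b /= h1 h2 okk; split=> //.
    by apply: h1 => //; rewrite ?eqxx ?ifF //; lia.
Qed.

Lemma Col_front : Col op u d w o = ncol_twist Q x0 w o (fun k p => frontR k p - frontL k p)%R.
Proof.
rewrite -ncol_twist_gauge // /Col /ncol; congr #|pred_of_set _|; apply/setP => g; rewrite !inE.
apply/idP/asboolP => [h|/colored_front h].
- apply/colored_front => k hk; apply/(col_ok_front g (Ordinal hk)) => s1 s2 t.
  by have /forallP/(_ s1)/forallP/(_ s2)/forallP := forallP h (Ordinal hk); apply.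
- apply/forallP => k; apply/forallP => s1; apply/forallP => s2; apply/forallP => t.
  by apply: (col_ok_front g k).2; apply: h.
Qed.

End Front.

(** * The quandle of a GL-rack *)

Section IntegerPowers.
Variable (gT : finGroupType).
Implicit Types (g : gT) (m n : int).
Local Open Scope group_scope.

Definition zpow g m : gT := match m with Posz k => g ^+ k | Negz k => g ^- k.+1 end.

Lemma zpow_succ g m : zpow g (m + 1)%R = zpow g m * g.
Proof.
case: m => [k|[|k]].
- by rewrite -PoszD addn1 /= expgSr.
- by rewrite /= mulVg.
- have -> : (Negz k.+1 + 1)%R = Negz k by lia.
  by rewrite /= [g ^+ k.+2]expgS invMg mulgKV.
Qed.

Lemma zpowD g m n : zpow g (m + n)%R = zpow g m * zpow g n.
Proof.
have pos k : zpow g (m + k%:Z)%R = zpow g m * g ^+ k.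
  elim: k => [|k IH]; first by rewrite addr0 mulg1.
  by rewrite -addn1 PoszD addrA zpow_succ IH expgD mulgA.
case: n => k; first by rewrite pos.
apply: (mulIg (g ^+ k.+1)); rewrite /= mulgKV.
elim: k m {pos} => [|k IH] m.
  by rewrite -zpow_succ; congr zpow; lia.
by rewrite expgS mulgA -zpow_succ -[in RHS](IH m); congr (zpow _ _ * _); lia.
Qed.

Lemma zpow_commute g g' m n : commute g g' -> commute (zpow g m) (zpow g' n).
Proof.
move=> cg; have H x y k : commute x y -> commute x (zpow y k).
  by move=> cxy; case: k => k /=; [|apply: commuteV]; exact: commuteX.
by apply: (H); apply: commute_sym; apply: (H); apply: commute_sym.
Qed.

End IntegerPowers.

Section GL.
Variables (X : finType) (op : X -> X -> X) (u d : X -> X).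
Hypothesis glr : GLrack op u d.

Let opI y : injective (fun x => op x y).
Proof. by case: glr => [[/(_ y)/bij_inj]]. Qed.
Let op_dist x y z : op (op x y) z = op (op x z) (op y z).
Proof. by case: glr => [[_ h] _ _ _]. Qed.
Let udK x : u (d (op x x)) = x.
Proof. by case: glr => [_ [h _] _ _]. Qed.
Let duK x : d (u (op x x)) = x.
Proof. by case: glr => [_ [_ h] _ _]. Qed.
Let u_opl x y : u (op x y) = op (u x) y.
Proof. by case: glr => [_ _ [h _] _]. Qed.
Let d_opl x y : d (op x y) = op (d x) y.
Proof. by case: glr => [_ _ [_ h] _]. Qed.
Let u_opr x y : op x (u y) = op x y.
Proof. by case: glr => [_ _ _ [h _]]. Qed.
Let d_opr x y : op x (d y) = op x y.
Proof. by case: glr => [_ _ _ [_ h]]. Qed.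

(** The composite of [u] and [d] is a left inverse of the diagonal map, which is thus injective and,
    by finiteness, onto. *)
Lemma diag_surj y : exists x, op x x = y.
Proof.
have inj : injective (fun x => op x x) by move=> x x' e; rewrite -(udK x) e udK.
by exists (invF inj y); rewrite (f_invF inj y).
Qed.

Lemma u_inj : injective u.
Proof.
move=> x y; have [x' <-] := diag_surj x; have [y' <-] := diag_surj y => e.
by rewrite -(duK x') e duK.
Qed.

Lemma d_inj : injective d.
Proof.
move=> x y; have [x' <-] := diag_surj x; have [y' <-] := diag_surj y => e.
by rewrite -(udK x') e udK.
Qed.

Definition pu : {perm X} := perm u_inj.
Definition pd : {perm X} := perm d_inj.

Lemma pud_commute : commute pu pd.
Proof.
apply/permP => x; rewrite !permM !permE /=.
by have [y <-] := diag_surj x; rewrite duK udK.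
Qed.

(** The free abelian group of rank two acts, rather than the permutation group generated by [u] and
    [d], so that a total twist is literally a pair of exponents. *)
Definition gl_act (a : int * int) (x : X) : X := (zpow pu a.1 * zpow pd a.2)%g x.

Lemma gl_act0 x : gl_act 0%R x = x.
Proof. by rewrite /gl_act /= mulg1 perm1. Qed.

Lemma gl_actD a b x : gl_act (a + b)%R x = gl_act a (gl_act b x).
Proof.
rewrite /gl_act -permM; congr (fun_of_perm _ x).
rewrite addrC /= !zpowD !mulgA; congr (_ * _)%g; rewrite -!mulgA; congr (_ * _)%g.
exact: zpow_commute pud_commute.
Qed.

(** This extends the axioms on [u] and [d] to all products of their integer powers. *)
Lemma gl_act_ind (P : (X -> X) -> Prop) : P id -> P u -> P d ->
  (forall f g, P f -> P g -> P (f \o g)) -> (forall f g, cancel f g -> P f -> P g) ->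
  forall a, P (gl_act a).
Proof.
move=> P1 Pu Pd PM PV.
have ext f g : f =1 g -> P f -> P g by move=> /funext ->.
have Pz (p : {perm X}) m : P p -> P (zpow p m).
  move=> Pp; have Pn k : P (p ^+ k)%g.
    elim: k => [|k IH]; first by apply: ext P1 => x; rewrite perm1.
    by apply: ext (PM _ _ Pp IH) => x; rewrite expgSr permM.
  case: m => k /=; first exact: Pn.
  by apply: PV (Pn k.+1); exact: permK.
move=> a; have Hu : P pu by apply: ext Pu => x; rewrite permE.
have Hd : P pd by apply: ext Pd => x; rewrite permE.
by apply: ext (PM _ _ (Pz pd a.2 Hd) (Pz pu a.1 Hu)) => x; rewrite /gl_act permM.
Qed.

Lemma gl_act_opl a x y : gl_act a (op x y) = op (gl_act a x) y.
Proof.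
move: a x y; apply: (gl_act_ind (P := fun f => forall x y, f (op x y) = op (f x) y)) => //.
- by move=> f g hf hg x y /=; rewrite hg hf.
- move=> f g fK hf x y; have [f' fK' f'K] : bijective f by apply: injF_bij; exact: can_inj fK.
  have gK z : f (g z) = z by rewrite -{1}(f'K z) fK f'K.
  by rewrite -{1}(gK x) -hf fK.
Qed.

Lemma gl_act_opr a x y : op x (gl_act a y) = op x y.
Proof.
move: a x y; apply: (gl_act_ind (P := fun f => forall x y, op x (f y) = op x y)) => //.
- by move=> f g hf hg x y /=; rewrite hf hg.
- move=> f g fK hf x y; have [f' fK' f'K] : bijective f by apply: injF_bij; exact: can_inj fK.
  have gK z : f (g z) = z by rewrite -{1}(f'K z) fK f'K.
  by rewrite -hf gK.
Qed.

Lemma gl_act_u x : gl_act (1, 0)%R x = u x.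
Proof. by rewrite /gl_act /= expg1 mulg1 permE. Qed.

Lemma gl_act_d x : gl_act (0, 1)%R x = d x.
Proof. by rewrite /gl_act /= expg1 mul1g permE. Qed.

Definition quandle_op x y := gl_act (1, 1)%R (op x y).

Lemma quandle_op_inj y : injective (fun x => quandle_op x y).
Proof. by move=> x x' /perm_inj/opI. Qed.

Definition gl_qop (s : bool) x y : X :=
  if s then quandle_op x y else invF (quandle_op_inj (y := y)) x.

Lemma gl_qopK s x y : gl_qop (~~ s) (gl_qop s x y) y = x.
Proof.
case: s => /=; first exact: (invF_f (quandle_op_inj (y := y))).
exact: (f_invF (quandle_op_inj (y := y))).
Qed.

Lemma gl_qop_inj s y : injective (fun x => gl_qop s x y).
Proof. by move=> x x' /= e; rewrite -(gl_qopK s x y) e gl_qopK. Qed.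

Lemma gl_qop_id s x : gl_qop s x x = x.
Proof.
have h : quandle_op x x = x.
  rewrite /quandle_op (_ : (1, 1)%R = ((1, 0) + (0, 1) : int * int)%R) //.
  by rewrite gl_actD gl_act_u gl_act_d udK.
by case: s => //; apply: (gl_qop_inj (s := true) (y := x)); rewrite (gl_qopK false) /= h.
Qed.

(** The positive law [TT] comes from the rack; the inverse operation is then allowed first inside
    ([TF]) and then outside, by cancelling the bijections [gl_qop true]. *)
Lemma gl_qop_dist s t x y z :
  gl_qop s (gl_qop t x y) z = gl_qop t (gl_qop s x z) (gl_qop s y z).
Proof.
have TT a b c : gl_qop true (gl_qop true a b) c = gl_qop true (gl_qop true a c) (gl_qop true b c).
  by rewrite /gl_qop /quandle_op !gl_act_opr -!gl_act_opl op_dist.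
have TF t' a b c : gl_qop true (gl_qop t' a b) c = gl_qop t' (gl_qop true a c) (gl_qop true b c).
  case: t' => //; apply: (gl_qop_inj (s := true) (y := gl_qop true b c)).
  by rewrite (gl_qopK false) -TT (gl_qopK false).
case: s; first exact: TF.
by apply: (gl_qop_inj (s := true) (y := z)); rewrite [RHS]TF !(gl_qopK false).
Qed.

Lemma gl_qop_actl s a x y : gl_act a (gl_qop s x y) = gl_qop s (gl_act a x) y.
Proof.
have T b z : gl_act a (gl_qop true z b) = gl_qop true (gl_act a z) b.
  by rewrite /gl_qop /quandle_op -gl_act_opl -!gl_actD addrC.
case: s; first exact: T.
by apply: (gl_qop_inj (s := true) (y := y)); rewrite -T !(gl_qopK false).
Qed.

Lemma gl_qop_actr s a x y : gl_qop s x (gl_act a y) = gl_qop s x y.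
Proof.
have T b z : gl_qop true b (gl_act a z) = gl_qop true b z.
  by rewrite /gl_qop /quandle_op gl_act_opr.
case: s; first exact: T.
by apply: (gl_qop_inj (s := true) (y := y)); rewrite -{1}T !(gl_qopK false).
Qed.

Definition gl_quandle : twquandle (int * int)%type X :=
  TwQuandle gl_qopK gl_qop_id gl_qop_dist gl_act0 gl_actD gl_qop_actl gl_qop_actr.

End GL.

Theorem theorem4p4 (w1 w2 : seq piece) (o1 o2 : nat -> nat -> bool) :
  is_front w1 -> is_front w2 -> is_knot w1 -> is_knot w2 ->
  oriented w1 o1 -> oriented w2 o2 ->
  top_equiv (w1, o1) (w2, o2) ->
  legtb w1 o1 = legtb w2 o2 -> legrot w1 o1 = legrot w2 o2 ->
  forall (X : finType) (op : X -> X -> X) (u d : X -> X),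
    GLrack op u d -> block_rack op ->
    Col op u d w1 o1 = Col op u d w2 o2.
Proof.
move=> f1 f2 k1 k2 or1 or2 eqv tb rot X op u d glr _.
have v1 : valid w1 by case/and3P: k1.
have v2 : valid w2 by case/and3P: k2.
(* Counting needs a default color [x0]. If [X] is empty both counts are 0, as a knot has at least
   one slot to color. *)
have [/card0_eq X0|/card_gt0P[x0 _]] := posnP #|X|.
  have e w o : is_knot w -> Col op u d w o = 0.
    move=> /knot_slot[s]; apply: eq_card0 => f; have := X0 (f s); by rewrite !inE.
  by rewrite !e.
pose Q := gl_quandle glr.
have uE x : u x = act Q (1, 0)%R x by rewrite /= gl_act_u.
have dE x : d x = act Q (0, 1)%R x by rewrite /= gl_act_d.
have opE x y : act Q ((1, 0) + (0, 1) : int * int)%R (op x y) = qop Q true x y by [].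
have C1 := Col_front x0 uE dE opE v1 f1 or1.
have C2 := Col_front x0 uE dE opE v2 f2 or2.
have [c [/= e1 e2]] := (equiv_transports Q x0 eqv).1 (fun k p =>
  frontR (1, 0) (0, 1) w1 o1 k p - frontL (1, 0) (0, 1) w1 o1 k p)%R.
rewrite C1 C2 e1; apply: knot_ncol => //; rewrite -e2 !total_front //.
move: tb rot; rewrite /legtb /legrot natrD => tb rot.
(* Both exponents are read off from the classical invariants: [n_up - writhe] is [- (tb + rot)] and
   [n_down - writhe] is [rot - tb]. *)
have eu : ((n_up w1 o1)%:Z - writhe w1 o1 = (n_up w2 o2)%:Z - writhe w2 o2)%R.
  by apply: (@intr_inj rat); rewrite !rmorphB /= -!pmulrn; lra.
have ed : ((n_down w1 o1)%:Z - writhe w1 o1 = (n_down w2 o2)%:Z - writhe w2 o2)%R.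
  by apply: (@intr_inj rat); rewrite !rmorphB /= -!pmulrn; lra.
by rewrite eu ed.
Qed.
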